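(* Let $\mathcal L\subset\mathbb R^2$ be a line which contains at least one badly approximable vector. Then for almost every $\mathbf v\in\mathcal L$ (with respect to the length measure on $\mathcal L$), $\mathbf v$ admits no improvement in Dirichlet's theorem.
   Context: $\|\cdot\|$ denotes the sup-norm on $\mathbb R^n$. For $\sigma\in(0,1)$, a vector $\mathbf v\in\mathbb R^n$ belongs to $\mathrm{DI}(\sigma)$ if for all sufficiently large $Q$ there exist $q\in\mathbb N$ and $\mathbf p\in\mathbb Z^n$ with $\|q\mathbf v-\mathbf p\|<\sigma Q^{-1/n}$ and $q<\sigma Q$. A vector $\mathbf v$ admits no improvement in Dirichlet's theorem if $\mathbf v\notin\bigcup_{0<\sigma<1}\mathrm{DI}(\sigma)$. A vector $\mathbf v\in\mathbb R^n$ is badly approximable if there is $c>0$ such that $\|q\mathbf v-\mathbf p\|\ge c\,q^{-1/n}$ for all $q\in\mathbb N$, $\mathbf p\in\mathbb Z^n$. Here $n=2$. *)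

(* Defs.v *)
From Stdlib Require Import Reals ZArith.
Open Scope R_scope.

Definition supnorm2 (x : R * R) : R := Rmax (Rabs (fst x)) (Rabs (snd x)).

Definition approx_err (v : R * R) (q : nat) (p1 p2 : Z) : R * R :=
  (INR q * fst v - IZR p1, INR q * snd v - IZR p2).

(* DI(sigma), n = 2: Q^{-1/n} = 1 / sqrt Q. *)
Definition DI (sigma : R) (v : R * R) : Prop :=
  exists Q0 : R, forall Q : R, Q0 <= Q -> 0 < Q ->
    exists (q : nat) (p1 p2 : Z),
      (1 <= q)%nat /\
      supnorm2 (approx_err v q p1 p2) < sigma * / sqrt Q /\
      INR q < sigma * Q.

Definition no_improvement_Dirichlet (v : R * R) : Prop :=
  ~ (exists sigma : R, 0 < sigma < 1 /\ DI sigma v).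

Definition badly_approximable (v : R * R) : Prop :=
  exists c : R, 0 < c /\
    forall (q : nat) (p1 p2 : Z), (1 <= q)%nat ->
      c * / sqrt (INR q) <= supnorm2 (approx_err v q p1 p2).

Definition lebesgue_null (S : R -> Prop) : Prop :=
  forall eps : R, 0 < eps ->
    exists l r : nat -> R,
      (forall n, l n <= r n) /\
      (forall x, S x -> exists n, l n <= x <= r n) /\
      (forall N, sum_f_R0 (fun n => r n - l n) N <= eps).

Definition line_pt (a b : R * R) (t : R) : R * R :=
  (fst a + t * fst b, snd a + t * snd b).

(* Main.v *)
(* After a change of coordinates the line is y = al x + be.  A point of it is not improvable at scale
   Q if there are integer vectors m = (r1, r2, q) and d = (A, B, C) with m in d^perp whose
   renormalized images are close to the flag (e_2, e_3^perp): then the lattice of the point at scale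
   Q is close to a critical lattice of the cube.  Writing X = q x + r1, l = q be - al r1 + r2,
   phi = A + al B and e(x) = C - phi x - B be, one has A r1 + B r2 + C q = phi X + B l + q e(x).

   Near a given x, Dirichlet's theorem gives m with l small, hence the scale Q = l^-2, and a second
   use of the pigeonhole principle gives d in m^perp with B much smaller than phi.  Solving
   Q e(x') = 1 approximately produces an interval of points x' near x, of proportion bounded from
   below, that are not improvable at scale Q.  This works unless x lies near a rational line of one
   of three special shapes at the scale S^2 from which m was built.  Such x occupy at most a sixth of
   any given interval for infinitely many S, provided y = al x + be is not itself a rational line,
   and a rational line carries no badly approximable vector.  So the points of an interval that are
   improvable at all large scales can be covered by intervals of total length at most a fixed
   fraction of its length; iterating, they form a null set. *)

Require Import Defs.
From Stdlib Require Import Reals ZArith Lra Lia Psatz List Classical IndefiniteDescription.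
Import ListNotations.
Open Scope R_scope.

(** * Coverings by finitely many intervals *)

Fixpoint total_length (s : list (R * R)) : R :=
  match s with
  | [] => 0
  | J :: s' => (snd J - fst J) + total_length s'
  end.

(** Finite families turn the lower bound for the length of an interval into an induction without
    compactness. Half-open intervals can be cut at a point without overlap or loss. *)
Definition covered (E : R -> Prop) (v : R) : Prop :=
  exists s : list (R * R),
    (forall I, In I s -> fst I <= snd I) /\
    (forall x, E x -> exists I, In I s /\ fst I <= x < snd I) /\
    total_length s <= v.

Lemma total_length_app s t : total_length (s ++ t) = total_length s + total_length t.
Proof.
  induction s as [|I s IH]; simpl; [|rewrite IH]; ring.
Qed.

Lemma total_length_nonneg s :
  (forall I, In I s -> fst I <= snd I) -> 0 <= total_length s.
Proof.
  induction s as [|I s IH]; simpl; intros H; [lra|].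
  assert (H1 := H I (or_introl eq_refl)).
  assert (H2 := IH (fun J h => H J (or_intror h))).
  lra.
Qed.

Lemma covered_mono (E F : R -> Prop) v w :
  (forall x, F x -> E x) -> v <= w -> covered E v -> covered F w.
Proof.
  intros HEF Hvw (s & H1 & H2 & H3); exists s; split; [|split]; auto; lra.
Qed.

Lemma covered_interval u v : u <= v -> covered (fun x => u <= x < v) (v - u).
Proof.
  intros H; exists [(u, v)]; split; [|split]; simpl.
  - intros I [<-|[]]; exact H.
  - intros x Hx; exists (u, v); auto.
  - lra.
Qed.

Lemma covered_union (E F : R -> Prop) v w :
  covered E v -> covered F w -> covered (fun x => E x \/ F x) (v + w).
Proof.
  intros (s & s1 & s2 & s3) (t & t1 & t2 & t3).
  exists (s ++ t); split; [|split].
  - intros I HI; apply in_app_or in HI as [HI|HI]; auto.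
  - intros x [Hx|Hx].
    + destruct (s2 x Hx) as (I & HI & h); exists I; split; auto; apply in_or_app; auto.
    + destruct (t2 x Hx) as (I & HI & h); exists I; split; auto; apply in_or_app; auto.
  - rewrite total_length_app; lra.
Qed.

Lemma covered_none (E : R -> Prop) v : 0 <= v -> (forall x, ~ E x) -> covered E v.
Proof.
  intros Hv HE; exists []; split; [|split]; simpl; auto.
  - intros I [].
  - intros x Hx; destruct (HE x Hx).
Qed.

Lemma covered_list_union (T : Type) (l : list T) (E : T -> R -> Prop) v :
  (forall i, In i l -> covered (E i) v) ->
  covered (fun x => exists i, In i l /\ E i x) (INR (length l) * v).
Proof.
  induction l as [|i l IH]; intros H.
  - simpl; apply covered_none; [lra|]; intros x (i & [] & _).
  - assert (Hc := covered_union _ _ _ _ (H i (or_introl eq_refl))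
                    (IH (fun j h => H j (or_intror h)))).
    eapply covered_mono; [| |exact Hc].
    + intros x (j & [->|Hj] & hx); [left | right; exists j]; auto.
    + change (length (i :: l)) with (S (length l)); rewrite S_INR; lra.
Qed.

(** Cutting each interval at [v] costs no length, because [Rmin p v + Rmax p v = p + v]; so a
    covering of a long interval can be distributed over its cells one at a time. *)
Lemma covered_split (E : R -> Prop) v w :
  covered E w ->
  exists w1 w2, covered (fun x => E x /\ x < v) w1 /\
    covered (fun x => E x /\ v <= x) w2 /\ 0 <= w1 /\ 0 <= w2 /\ w1 + w2 <= w.
Proof.
  intros (s & s1 & s2 & s3).
  set (lo := map (fun I => (Rmin (fst I) v, Rmin (snd I) v)) s).
  set (hi := map (fun I => (Rmax (fst I) v, Rmax (snd I) v)) s).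
  assert (Hlo : forall I, In I lo -> fst I <= snd I).
  { intros I HI; apply in_map_iff in HI as (J & <- & HJ); simpl.
    apply s1 in HJ; unfold Rmin; repeat destruct Rle_dec; lra. }
  assert (Hhi : forall I, In I hi -> fst I <= snd I).
  { intros I HI; apply in_map_iff in HI as (J & <- & HJ); simpl.
    apply s1 in HJ; unfold Rmax; repeat destruct Rle_dec; lra. }
  exists (total_length lo), (total_length hi).
  split; [|split; [|split; [|split]]].
  - exists lo; split; [|split]; auto; [|lra].
    intros x [Hx Hv]; destruct (s2 x Hx) as (I & HI & h).
    exists (Rmin (fst I) v, Rmin (snd I) v); split.
    + apply in_map_iff; exists I; auto.
    + simpl; unfold Rmin; repeat destruct Rle_dec; lra.
  - exists hi; split; [|split]; auto; [|lra].
    intros x [Hx Hv]; destruct (s2 x Hx) as (I & HI & h).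
    exists (Rmax (fst I) v, Rmax (snd I) v); split.
    + apply in_map_iff; exists I; auto.
    + simpl; unfold Rmax; repeat destruct Rle_dec; lra.
  - apply total_length_nonneg, Hlo.
  - apply total_length_nonneg, Hhi.
  - enough (total_length lo + total_length hi = total_length s) by lra.
    clear - s; unfold lo, hi; induction s as [|I s IH]; simpl; [ring|].
    rewrite <- IH.
    assert (H : forall p, Rmin p v + Rmax p v = p + v)
      by (intros p; unfold Rmin, Rmax; destruct Rle_dec; ring).
    assert (H1 := H (fst I)); assert (H2 := H (snd I)); lra.
Qed.

(* Remove the interval that contains the left end point and recurse on what is left. *)
Lemma covered_interval_lower_bound u v w :
  u <= v -> covered (fun x => u <= x < v) w -> v - u <= w.
Proof.
  intros Huv (s & s1 & s2 & s3).
  enough (v - u <= total_length s) by lra.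
  clear s3 w; remember (length s) as n eqn:Hn.
  revert u s Huv Hn s1 s2; induction n as [|n IH]; intros u s Huv Hn s1 s2.
  - destruct s; [|discriminate]; simpl.
    destruct (Rle_lt_dec v u) as [h|h]; [lra|].
    destruct (s2 u) as (I & [] & _); lra.
  - destruct (Rle_lt_dec v u) as [h|h].
    { assert (H := total_length_nonneg s s1); lra. }
    destruct (s2 u) as (I & HI & hI); [lra|].
    destruct (in_split _ _ HI) as (t1 & t2 & ->).
    rewrite length_app in Hn; simpl in Hn.
    assert (Ht : forall J, In J (t1 ++ t2) -> In J (t1 ++ I :: t2)).
    { intros J HJ; apply in_app_or in HJ as [?|?]; apply in_or_app; simpl; auto. }
    assert (Hnn : forall J, In J (t1 ++ t2) -> fst J <= snd J) by auto.
    replace (total_length (t1 ++ I :: t2)) with (snd I - fst I + total_length (t1 ++ t2))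
      by (rewrite !total_length_app; simpl; ring).
    destruct (Rle_lt_dec v (snd I)) as [h'|h'].
    + assert (H := total_length_nonneg _ Hnn); lra.
    + enough (v - snd I <= total_length (t1 ++ t2)) by lra.
      apply IH; [lra | rewrite length_app; lia | exact Hnn |].
      intros x Hx; destruct (s2 x) as (J & HJ & hJ); [lra|].
      exists J; split; [|lra].
      apply in_app_or in HJ as [HJ|[HJ|HJ]]; apply in_or_app; auto.
      subst J; lra.
Qed.

(** A cell whose middle third lies in [B] uses up at least [lam / 3] of the covering of [B]; every
    other cell saves the proportion [c]. A bad cell costs [(1 - c) * lam + c * lam], and the excess
    [c * lam] is at most [3 * c] times the part of [w] spent in it. *)
Lemma covered_packing (E B : R -> Prop) lam c (K : nat) u w :
  0 < lam -> 0 <= c <= 1 ->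
  (forall i, (i < K)%nat ->
     (forall x, u + INR i * lam + lam / 3 <= x < u + INR i * lam + 2 * lam / 3 -> B x) \/
     covered (fun x => E x /\ u + INR i * lam <= x < u + INR (S i) * lam) ((1 - c) * lam)) ->
  covered (fun x => B x /\ u <= x < u + INR K * lam) w ->
  covered (fun x => E x /\ u <= x < u + INR K * lam)
    (INR K * lam * (1 - c) + 3 * c * w).
Proof.
  intros Hlam Hc; revert w; induction K as [|K IH]; intros w Hcell HB.
  - apply covered_none.
    + assert (0 <= w).
      { destruct HB as (s & s1 & _ & s3).
        assert (H := total_length_nonneg s s1); lra. }
      simpl; nra.
    + simpl; intros x [_ Hx]; lra.
  - destruct (covered_split _ (u + INR K * lam) _ HB) as (w1 & w2 & H1 & H2 & h1 & h2 & h3).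
    assert (HK : INR (S K) = INR K + 1) by apply S_INR.
    assert (HK0 : 0 <= INR K) by apply pos_INR.
    assert (IH1 : covered (fun x => E x /\ u <= x < u + INR K * lam)
      (INR K * lam * (1 - c) + 3 * c * w1)).
    { apply IH.
      - intros i Hi; apply Hcell; lia.
      - eapply covered_mono; [| |exact H1]; [|lra].
        intros x [Hx h]; rewrite HK; split; [split; auto; nra | lra]. }
    assert (IH2 : covered (fun x => E x /\ u + INR K * lam <= x < u + INR (S K) * lam)
      ((1 - c) * lam + 3 * c * w2)).
    { destruct (Hcell K) as [Hb|Hg]; [lia| |].
      - assert (Hw : lam / 3 <= w2).
        { replace (lam / 3) with ((u + INR K * lam + 2 * lam / 3) - (u + INR K * lam + lam / 3))
            by field.
          apply covered_interval_lower_bound; [lra|].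
          eapply covered_mono; [| |exact H2]; [|lra].
          intros x Hx; split; [split; [apply Hb; lra|]|]; rewrite ?HK; nra. }
        eapply covered_mono;
          [| |apply (covered_interval (u + INR K * lam) (u + INR (S K) * lam))].
        + intros x [_ Hx]; exact Hx.
        + rewrite HK; nra.
        + rewrite HK; nra.
      - eapply covered_mono; [| |exact Hg]; [auto|nra]. }
    eapply covered_mono; [| |exact (covered_union _ _ _ _ IH1 IH2)].
    + intros x [Hx h]; destruct (Rlt_le_dec x (u + INR K * lam)); [left | right]; split; auto; lra.
    + rewrite HK; nra.
Qed.

(** Each interval of the covering at stage [n] is covered again with total length [c] times its
    own. *)
Lemma covered_contraction (E : R -> Prop) c :
  0 <= c ->
  (forall u v, u < v -> covered (fun x => E x /\ u <= x < v) (c * (v - u))) ->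
  forall n u v, u <= v -> covered (fun x => E x /\ u <= x < v) (c ^ n * (v - u)).
Proof.
  intros Hc H; induction n as [|n IH]; intros u v Huv.
  - eapply covered_mono; [| |apply (covered_interval u v Huv)]; [tauto|simpl; lra].
  - destruct (IH u v Huv) as (s & s1 & s2 & s3).
    enough (Hs : covered (fun x => E x /\ exists I, In I s /\ fst I <= x < snd I)
      (c * total_length s)).
    { eapply covered_mono; [| |exact Hs].
      - intros x Hx; split; [tauto|]; auto.
      - simpl; nra. }
    clear s2 s3; induction s as [|I s IHs].
    + apply covered_none; [simpl; lra|]; intros x (_ & I & [] & _).
    + assert (HI := s1 I (or_introl eq_refl)).
      assert (Hs := IHs (fun J h => s1 J (or_intror h))).
      assert (Hc1 : covered (fun x => E x /\ fst I <= x < snd I) (c * (snd I - fst I))).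
      { destruct (Req_dec (fst I) (snd I)) as [h|h].
        - apply covered_none; [rewrite h; lra|]; intros x [_ hx]; lra.
        - apply H; lra. }
      eapply covered_mono; [| |exact (covered_union _ _ _ _ Hc1 Hs)].
      * intros x (Hx & J & [->|HJ] & hJ); [left | right; split; [|exists J]]; auto.
      * simpl; lra.
Qed.

(** * From finite coverings to null sets *)

Lemma sum_lengths_le_total (s : list (R * R)) N :
  (forall I, In I s -> fst I <= snd I) ->
  sum_f_R0 (fun n => snd (nth n s (0, 0)) - fst (nth n s (0, 0))) N <= total_length s.
Proof.
  revert N; induction s as [|I s IH]; intros N H.
  (* Beyond the end of the list the default [(0, 0)] contributes length zero. *)
  - enough (sum_f_R0 (fun n => snd (nth n [] (0, 0)) - fst (nth n [] (0, 0))) N = 0)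
      by (simpl in *; lra).
    induction N as [|N IHN]; [simpl; ring|].
    change (sum_f_R0 (fun n => snd (nth n [] (0, 0)) - fst (nth n [] (0, 0))) N +
      (snd (nth (S N) [] (0, 0)) - fst (nth (S N) [] (0, 0))) = 0).
    rewrite IHN; simpl; ring.
  - assert (Hs : forall J, In J s -> fst J <= snd J) by (intros; apply H; right; auto).
    destruct N as [|N].
    + simpl; assert (h := total_length_nonneg s Hs); lra.
    + rewrite decomp_sum by lia; simpl.
      assert (h := IH N Hs); simpl in h; lra.
Qed.

(** The [n]-th set receives total length [eps / 2 * (/ 2) ^ n], and the finite lists are
    concatenated into one sequence of intervals. *)
Lemma lebesgue_null_increasing_union (S : R -> Prop) (T : nat -> R -> Prop) :
  (forall x, S x -> exists n, T n x) ->
  (forall n eps, 0 < eps -> covered (T n) eps) ->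
  lebesgue_null S.
Proof.
  intros HST HT eps Heps.
  assert (Hn : forall n, exists s : list (R * R), s <> [] /\
    (forall I, In I s -> fst I <= snd I) /\
    (forall x, T n x -> exists I, In I s /\ fst I <= x < snd I) /\
    total_length s <= eps / 2 * (/ 2) ^ n).
  { intros n.
    assert (Hp : 0 < eps / 2 * (/ 2) ^ n).
    { apply Rmult_lt_0_compat; [lra | apply pow_lt; lra]. }
    destruct (HT n _ Hp) as (s & s1 & s2 & s3).
    (* The degenerate interval makes every list nonempty, so the first [n + 1] lists together have
       more than [n] entries. *)
    exists ((0, 0) :: s); split; [discriminate|split; [|split]].
    - intros I [<-|HI]; simpl; [lra | auto].
    - intros x Hx; destruct (s2 x Hx) as (I & HI & h); exists I; split; auto; right; auto.
    - simpl; lra. }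
  apply functional_choice in Hn as (f & Hf).
  (* [C n] is a prefix of every later [C m], so its entry of index [n] does not depend on the stage
     and defines the sequence. *)
  set (C := fix C n := match n with O => f O | Datatypes.S m => C m ++ f (Datatypes.S m) end).
  assert (Clen : forall n, (n < length (C n))%nat).
  { induction n as [|n IH]; simpl.
    - destruct (Hf O) as (h & _); destruct (f O); [contradiction | simpl; lia].
    - rewrite length_app; destruct (Hf (Datatypes.S n)) as (h & _).
      destruct (f (Datatypes.S n)); [contradiction | simpl; lia]. }
  assert (Cinc : forall n m, (n <= m)%nat -> exists t, C m = C n ++ t).
  { intros n m Hnm; induction Hnm as [|m Hnm (t & IH)].
    - exists []; rewrite app_nil_r; reflexivity.
    - exists (t ++ f (Datatypes.S m)); simpl; rewrite IH, app_assoc; reflexivity. }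
  assert (Cnth : forall i n d, (i <= n)%nat -> nth i (C i) d = nth i (C n) d).
  { intros i n d Hin; destruct (Cinc i n Hin) as (t & ->).
    rewrite app_nth1; auto. }
  assert (Cok : forall n I, In I (C n) -> fst I <= snd I).
  { induction n as [|n IH]; simpl; intros I HI.
    - apply (Hf O); auto.
    - apply in_app_or in HI as [HI|HI]; auto; apply (Hf (Datatypes.S n)); auto. }
  assert (Ctot : forall n, total_length (C n) <= eps * (1 - (/ 2) ^ (Datatypes.S n))).
  { induction n as [|n IH].
    - destruct (Hf O) as (_ & _ & _ & h); simpl in *; lra.
    - destruct (Hf (Datatypes.S n)) as (_ & _ & _ & h).
      change (C (Datatypes.S n)) with (C n ++ f (Datatypes.S n)).
      rewrite total_length_app; simpl in *; lra. }
  exists (fun n => fst (nth n (C n) (0, 0))), (fun n => snd (nth n (C n) (0, 0))).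
  split; [|split].
  - intros n; apply (Cok n), nth_In, Clen.
  - intros x Hx; destruct (HST x Hx) as (n & Hxn).
    destruct (Hf n) as (_ & _ & h & _); destruct (h x Hxn) as (I & HI & hI).
    assert (HIn : In I (C n)).
    { destruct n; simpl; auto; apply in_or_app; auto. }
    destruct (In_nth _ _ (0, 0) HIn) as (i & Hi & Hnth).
    exists i.
    assert (Hii : nth i (C i) (0, 0) = I).
    { rewrite <- Hnth; destruct (le_lt_dec i n) as [hin|hin]; [apply Cnth; auto|].
      destruct (Cinc n i) as (t & ->); [lia|]; rewrite app_nth1; auto. }
    rewrite Hii; lra.
  - intros N; apply Rle_trans with (total_length (C N)).
    + eapply Rle_trans; [|apply (sum_lengths_le_total _ N (Cok N))].
      right; apply sum_eq; intros i Hi; rewrite (Cnth i N) by auto; reflexivity.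
    + assert (h := Ctot N).
      assert (0 < (/ 2) ^ Datatypes.S N) by (apply pow_lt; lra); nra.
Qed.

Lemma covered_arbitrarily_small (E : R -> Prop) c :
  0 <= c < 1 ->
  (forall u v, u < v -> covered (fun x => E x /\ u <= x < v) (c * (v - u))) ->
  forall u v eps, 0 < eps -> covered (fun x => E x /\ u <= x < v) eps.
Proof.
  intros [Hc0 Hc1] H u v eps Heps.
  destruct (Rle_lt_dec v u) as [h|h].
  { apply covered_none; [lra|]; intros x [_ hx]; lra. }
  assert (Hq : 0 < eps / (v - u)) by (apply Rdiv_lt_0_compat; lra).
  destruct (pow_lt_1_zero c) with (y := eps / (v - u)) as (n & Hn); auto.
  { rewrite Rabs_right; lra. }
  specialize (Hn n (Nat.le_refl n)).
  eapply covered_mono; [| |apply (covered_contraction E c Hc0 H n u v)]; [tauto| |lra].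
  apply Rabs_def2 in Hn as [Hn _].
  apply (Rmult_lt_compat_r (v - u)) in Hn; [|lra].
  replace (eps / (v - u) * (v - u)) with eps in Hn by (field; lra); lra.
Qed.

(** For negative [k] the preimage of a half-open interval is closed at the other end; doubling the
    length recovers that end point. *)
Lemma covered_affine_preimage (E : R -> Prop) p k v :
  k <> 0 -> covered E v -> covered (fun t => E (p + t * k)) (2 * v / Rabs k).
Proof.
  intros Hk (s & s1 & s2 & s3).
  assert (Hk' : 0 < Rabs k) by (apply Rabs_pos_lt; exact Hk).
  assert (Hki : 0 < / Rabs k) by (apply Rinv_0_lt_compat; exact Hk').
  set (g := fun I : R * R =>
    (Rmin ((fst I - p) / k) ((snd I - p) / k),
     Rmin ((fst I - p) / k) ((snd I - p) / k) + 2 * (snd I - fst I) / Rabs k)).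
  exists (map g s); split; [|split].
  - intros J HJ; apply in_map_iff in HJ as (I & <- & HI); simpl.
    apply s1 in HI; unfold Rdiv; nra.
  - intros t Ht; destruct (s2 _ Ht) as (I & HI & h).
    exists (g I); split; [apply in_map; exact HI|]; simpl.
    assert (Hm : (fst I - p) / k <= t < (fst I - p) / k + 2 * (snd I - fst I) / Rabs k /\
      (fst I - p) / k <= (snd I - p) / k \/
      (snd I - p) / k <= t < (snd I - p) / k + 2 * (snd I - fst I) / Rabs k /\
      (snd I - p) / k <= (fst I - p) / k).
    { set (f := (fst I - p) / k); set (q := (snd I - p) / k).
      set (w := (snd I - fst I) / Rabs k).
      replace (2 * (snd I - fst I) / Rabs k) with (2 * w) by (unfold w; field; lra).
      assert (Hf : fst I = f * k + p) by (unfold f; field; exact Hk).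
      assert (Hq : snd I = q * k + p) by (unfold q; field; exact Hk).
      assert (Hw : snd I - fst I = w * Rabs k) by (unfold w; field; lra).
      destruct (Rlt_le_dec 0 k) as [k0|k0].
      - left; rewrite Rabs_right in Hw, Hk' by lra; split; [split|]; nra.
      - right; rewrite Rabs_left in Hw, Hk' by lra; split; [split|]; nra. }
    unfold Rmin; destruct Rle_dec; lra.
  - apply Rle_trans with (2 / Rabs k * total_length s).
    + clear s1 s2 s3; induction s as [|I s IH]; simpl; [lra|].
      eapply Rle_trans; [apply Rplus_le_compat_l; exact IH|].
      right; field; lra.
    + replace (2 * v / Rabs k) with (2 / Rabs k * v) by (field; lra).
      apply Rmult_le_compat_l; [unfold Rdiv; lra | lra].
Qed.

(** * Integer vectors and the pigeonhole principle *)

Lemma exists_floor (r : R) : exists z : Z, IZR z <= r < IZR z + 1.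
Proof.
  exists (up r - 1)%Z; rewrite minus_IZR; destruct (archimed r); lra.
Qed.

Lemma exists_nat_ceil (r : R) : 0 <= r -> exists n : nat, r < INR n <= r + 1.
Proof.
  intros Hr; destruct (exists_floor r) as (z & Hz).
  assert (0 <= z)%Z.
  { assert (h : (-1 < z)%Z) by (apply lt_IZR; simpl; lra); lia. }
  exists (Z.to_nat (z + 1)).
  rewrite INR_IZR_INZ, Z2Nat.id, plus_IZR by lia; lra.
Qed.

Lemma IZR_small_zero (z : Z) : Rabs (IZR z) < 1 -> z = 0%Z.
Proof.
  intros H; apply Rabs_def2 in H as [H1 H2].
  apply lt_IZR in H1; assert (h : (-1 < z)%Z) by (apply lt_IZR; simpl; lra); lia.
Qed.

Lemma IZR_Rabs_ge_1 (z : Z) : z <> 0%Z -> 1 <= Rabs (IZR z).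
Proof.
  intros H; destruct (Rle_lt_dec 1 (Rabs (IZR z))) as [h|h]; auto.
  destruct (H (IZR_small_zero z h)).
Qed.

Definition Zrange (p q : R) : list Z :=
  map (fun i => up p - 1 + Z.of_nat i)%Z (seq 0 (Z.to_nat (up q - up p + 1))).

Lemma In_Zrange p q z : p <= IZR z <= q -> In z (Zrange p q).
Proof.
  intros [H1 H2]; apply in_map_iff; exists (Z.to_nat (z - (up p - 1))).
  destruct (archimed p) as [p1 p2]; destruct (archimed q) as [q1 q2].
  assert (h1 : (up p - 1 <= z)%Z) by (apply le_IZR; rewrite minus_IZR; lra).
  assert (h2 : (z < up q)%Z) by (apply lt_IZR; lra).
  split; [lia|]; apply in_seq; lia.
Qed.

Lemma length_Zrange p q : p <= q -> INR (length (Zrange p q)) <= q - p + 2.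
Proof.
  intros H; unfold Zrange; rewrite length_map, length_seq.
  destruct (archimed p) as [p1 p2]; destruct (archimed q) as [q1 q2].
  assert (h : (up p - 1 < up q)%Z) by (apply lt_IZR; rewrite minus_IZR; lra).
  rewrite INR_IZR_INZ, Z2Nat.id, plus_IZR, minus_IZR by lia; lra.
Qed.

Lemma pigeonhole (N M : nat) (f : nat -> nat) :
  (M < N)%nat -> (forall i, (i < N)%nat -> (f i < M)%nat) ->
  exists i j, (i < j < N)%nat /\ f i = f j.
Proof.
  intros HMN Hf; apply NNPP; intros Hno.
  assert (Hnd : forall n, (n <= N)%nat -> NoDup (map f (seq 0 n))).
  { induction n as [|n IH]; intros Hn; [constructor|].
    rewrite seq_S, map_app; simpl; apply NoDup_app; [apply IH; lia | repeat constructor; auto |].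
    intros y Hy [<-|[]]; apply in_map_iff in Hy as (i & Hi & Hin); apply in_seq in Hin.
    apply Hno; exists i, n; split; [lia | exact Hi]. }
  assert (Hle : (length (map f (seq 0 N)) <= length (seq 0 M))%nat).
  { apply NoDup_incl_length; [apply Hnd; lia|].
    intros y Hy; apply in_map_iff in Hy as (i & <- & Hin); apply in_seq in Hin.
    apply in_seq; assert (h := Hf i ltac:(lia)); lia. }
  rewrite length_map, !length_seq in Hle; lia.
Qed.

(** With [[0, W)] cut into [b] equal pieces, this is the index of the piece containing [y];
    [up _ - 1] is the floor. *)
Definition bin (b : nat) (W y : R) : nat := Z.to_nat (up (y * INR b / W) - 1).

Lemma bin_bounds b W y : 0 < W -> 0 <= y < W ->
  INR (bin b W y) <= y * INR b / W < INR (bin b W y) + 1.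
Proof.
  intros HW Hy; unfold bin.
  set (t := y * INR b / W); destruct (archimed t) as [t1 t2].
  assert (Ht : 0 <= t).
  { assert (hb := pos_INR b); unfold t.
    apply Rmult_le_pos; [nra | left; apply Rinv_0_lt_compat; lra]. }
  assert (h : (0 < up t)%Z) by (apply lt_IZR; lra).
  rewrite INR_IZR_INZ, Z2Nat.id, minus_IZR by lia; lra.
Qed.

Lemma bin_lt b W y : (0 < b)%nat -> 0 < W -> 0 <= y < W -> (bin b W y < b)%nat.
Proof.
  intros Hb HW Hy; apply INR_lt.
  assert (hb : 0 < INR b) by (apply lt_0_INR; exact Hb).
  apply Rle_lt_trans with (y * INR b / W); [apply bin_bounds; auto|].
  apply (Rmult_lt_reg_r W); [exact HW|].
  replace (y * INR b / W * W) with (y * INR b) by (field; lra); nra.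
Qed.

Lemma bin_eq b W y y' : 0 < W -> 0 <= y < W -> 0 <= y' < W ->
  bin b W y = bin b W y' -> Rabs (y - y') * INR b < W.
Proof.
  intros HW Hy Hy' He.
  assert (h := bin_bounds b W y HW Hy); assert (h' := bin_bounds b W y' HW Hy').
  rewrite <- He in h'.
  assert (hb := pos_INR b).
  rewrite <- (Rabs_right (INR b)), <- Rabs_mult by lra.
  replace ((y - y') * INR b) with ((y * INR b / W - y' * INR b / W) * W) by (field; lra).
  rewrite Rabs_mult, (Rabs_right W) by lra.
  assert (Rabs (y * INR b / W - y' * INR b / W) < 1) by (apply Rabs_def1; lra).
  nra.
Qed.

Lemma pigeonhole_bins (N M b : nat) (g : nat -> nat) (h : nat -> R) (W : R) :
  0 < W -> (0 < b)%nat -> (M * b < N)%nat ->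
  (forall i, (i < N)%nat -> (g i < M)%nat) ->
  (forall i, (i < N)%nat -> 0 <= h i < W) ->
  exists i j, (i < j < N)%nat /\ g i = g j /\ Rabs (h i - h j) * INR b < W.
Proof.
  intros HW Hb HN Hg Hh.
  (* A class below [M] and a bin below [b] are encoded as one number below [M * b], from which both
     can be recovered. *)
  destruct (pigeonhole N (M * b) (fun i => g i * b + bin b W (h i))%nat) as (i & j & Hij & He);
    [exact HN | |].
  - intros i Hi; assert (h1 := Hg i Hi); assert (h2 := bin_lt b W (h i) Hb HW (Hh i Hi)); nia.
  - assert (bi := bin_lt b W (h i) Hb HW (Hh i ltac:(lia))).
    assert (bj := bin_lt b W (h j) Hb HW (Hh j ltac:(lia))).
    exists i, j; split; [exact Hij|].
    assert (g i = g j) by nia.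
    split; [assumption|].
    apply bin_eq; [exact HW | apply Hh; lia | apply Hh; lia | nia].
Qed.

Definition frac (r : R) : R := r - IZR (up r - 1).

Lemma frac_bounds r : 0 <= frac r < 1.
Proof.
  unfold frac; rewrite minus_IZR; destruct (archimed r); lra.
Qed.

(** Since [r1] enters the second form, the integer parts for the first form are fixed beforehand for
    every multiple [i]. The pigeonhole principle then applies to the pairs of fractional parts of
    [n1 * n2 + 1] multiples. *)
Lemma simultaneous_dirichlet (x al be : R) (n1 n2 : nat) :
  (0 < n1)%nat -> (0 < n2)%nat ->
  exists q r1 r2 : Z, (1 <= q <= Z.of_nat (n1 * n2))%Z /\
    Rabs (IZR q * x + IZR r1) * INR n1 < 1 /\
    Rabs (IZR q * be - al * IZR r1 + IZR r2) * INR n2 < 1.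
Proof.
  intros H1 H2.
  set (r := fun i : nat => (- (up (INR i * x) - 1))%Z).
  set (y := fun i : nat => INR i * be - al * IZR (r i)).
  destruct (pigeonhole_bins (S (n1 * n2)) n1 n2
    (fun i => bin n1 1 (frac (INR i * x))) (fun i => frac (y i)) 1)
    as (i & j & Hij & Hg & Hh); [lra | exact H2 | lia | | |].
  - intros i _; apply bin_lt; [exact H1 | lra | apply frac_bounds].
  - intros i _; apply frac_bounds.
  - apply bin_eq in Hg; [|lra|apply frac_bounds|apply frac_bounds].
    exists (Z.of_nat j - Z.of_nat i)%Z, (r j - r i)%Z, ((- (up (y j) - 1)) - (- (up (y i) - 1)))%Z.
    split; [lia|].
    split.
    + rewrite Rabs_minus_sym in Hg.
      replace (IZR (Z.of_nat j - Z.of_nat i) * x + IZR (r j - r i))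
        with (frac (INR j * x) - frac (INR i * x)); [exact Hg|].
      unfold frac, r; rewrite !minus_IZR, !opp_IZR, <- !INR_IZR_INZ, !minus_IZR; ring.
    + rewrite Rabs_minus_sym in Hh.
      match goal with |- Rabs ?e * _ < _ => replace e with (frac (y j) - frac (y i)) end;
        [exact Hh|].
      unfold frac, y; rewrite !minus_IZR, !opp_IZR, <- !INR_IZR_INZ, !minus_IZR; ring.
Qed.

(* Pigeonhole principle on the residue of [A * r1 + B * r2] modulo [q] together with one of [b] bins
   for the value of the last form; larger [b] trades box size for a sharper bound on that form. *)
Lemma orthogonal_dirichlet (al X l W : R) (r1 r2 q : Z) (nu nt b : nat) :
  (0 < q)%Z -> (0 < b)%nat -> (q * Z.of_nat b < Z.of_nat (nu * nt))%Z ->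
  2 * (INR nu * Rabs X + INR nt * Rabs l) < W ->
  exists A B C : Z, (A <> 0 \/ B <> 0)%Z /\ (A * r1 + B * r2 + C * q = 0)%Z /\
    Rabs (IZR A + al * IZR B) < INR nu /\ Rabs (IZR B) <= INR nt - 1 /\
    Rabs ((IZR A + al * IZR B) * X + IZR B * l) * INR b < W.
Proof.
  intros Hq Hb HN HW.
  assert (Hnt : (0 < nt)%nat) by (destruct nt; lia).
  set (B := fun i : nat => Z.of_nat (i mod nt)).
  (* This shift makes [A + al * B] equal to [i / nt] plus a fractional part, so the [nu * nt]
     vectors stay in a box of sides [nu] and [nt]. *)
  set (A := fun i : nat => (Z.of_nat (i / nt) - (up (al * IZR (B i)) - 1))%Z).
  set (V := INR nu * Rabs X + INR nt * Rabs l) in *.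
  set (w := fun i => (IZR (A i) + al * IZR (B i)) * X + IZR (B i) * l).
  assert (Hphi : forall i, IZR (A i) + al * IZR (B i) = INR (i / nt) + frac (al * IZR (B i))).
  { intros i; unfold A, frac; rewrite (minus_IZR (Z.of_nat (i / nt))), <- INR_IZR_INZ; ring. }
  assert (Hdiv : forall i, (i < nu * nt)%nat -> INR (i / nt) <= INR nu - 1).
  { intros i Hi; assert (h : (i / nt < nu)%nat) by (apply Nat.Div0.div_lt_upper_bound; lia).
    replace (INR nu - 1) with (INR (nu - 1)) by (rewrite minus_INR by lia; reflexivity).
    apply le_INR; lia. }
  assert (HB : forall i, 0 <= IZR (B i) <= INR nt - 1).
  { intros i; unfold B; rewrite <- INR_IZR_INZ; split; [apply pos_INR|].
    assert (h := Nat.mod_upper_bound i nt ltac:(lia)).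
    replace (INR nt - 1) with (INR (nt - 1)) by (rewrite minus_INR by lia; reflexivity).
    apply le_INR; lia. }
  assert (Hw : forall i, (i < nu * nt)%nat -> 0 <= w i + V < W).
  { intros i Hi.
    assert (h : Rabs (w i) <= V).
    { unfold w, V; eapply Rle_trans; [apply Rabs_triang|]; rewrite !Rabs_mult.
      apply Rplus_le_compat; apply Rmult_le_compat_r; try apply Rabs_pos.
      - rewrite Hphi; assert (f := frac_bounds (al * IZR (B i))).
        assert (g := Hdiv i Hi); assert (p := pos_INR (i / nt)).
        rewrite Rabs_right; lra.
      - rewrite Rabs_right; assert (g := HB i); lra. }
    revert h; unfold Rabs at 1; destruct Rcase_abs; intros; lra. }
  destruct (pigeonhole_bins (nu * nt) (Z.to_nat q) b
    (fun i => Z.to_nat ((A i * r1 + B i * r2) mod q)) (fun i => w i + V) W)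
    as (i & j & Hij & Hg & Hh).
  - destruct (Hw O) as [h1 h2]; [lia | lra].
  - exact Hb.
  - lia.
  - intros i _; assert (h := Z.mod_pos_bound (A i * r1 + B i * r2) q Hq); lia.
  - exact Hw.
  - assert (h1 := Z.mod_pos_bound (A i * r1 + B i * r2) q Hq).
    assert (h2 := Z.mod_pos_bound (A j * r1 + B j * r2) q Hq).
    assert (Hdvd : ((A j * r1 + B j * r2) mod q = (A i * r1 + B i * r2) mod q)%Z) by lia.
    assert (e1 := Z.div_mod (A i * r1 + B i * r2) q ltac:(lia)).
    assert (e2 := Z.div_mod (A j * r1 + B j * r2) q ltac:(lia)).
    (* The residues agree, so the difference of the quotients serves as [C]. *)
    exists (A j - A i)%Z, (B j - B i)%Z,
      ((A i * r1 + B i * r2) / q - (A j * r1 + B j * r2) / q)%Z.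
    split; [|split; [|split; [|split]]].
    + destruct (Z.eq_dec (B j) (B i)) as [Heq|Hne]; [left | right; lia].
      intros HA; assert (HA' : A j = A i) by lia.
      unfold A in HA'; rewrite Heq in HA'.
      assert (Hd : (i / nt = j / nt)%nat) by lia.
      assert (Hm : (i mod nt = j mod nt)%nat) by (unfold B in Heq; lia).
      assert (d1 := Nat.div_mod_eq i nt); assert (d2 := Nat.div_mod_eq j nt).
      rewrite <- Hd, <- Hm in d2; lia.
    + rewrite Hdvd in e2; nia.
    + replace (IZR (A j - A i) + al * IZR (B j - B i))
        with ((IZR (A j) + al * IZR (B j)) - (IZR (A i) + al * IZR (B i)))
        by (rewrite !minus_IZR; ring).
      rewrite !Hphi.
      assert (f1 := frac_bounds (al * IZR (B i))); assert (f2 := frac_bounds (al * IZR (B j))).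
      assert (g1 := Hdiv i ltac:(lia)); assert (g2 := Hdiv j ltac:(lia)).
      assert (p1 := pos_INR (i / nt)); assert (p2 := pos_INR (j / nt)).
      apply Rabs_def1; lra.
    + rewrite minus_IZR; assert (g1 := HB i); assert (g2 := HB j).
      unfold Rabs; destruct Rcase_abs; lra.
    + rewrite Rabs_minus_sym in Hh.
      match goal with |- Rabs ?e * _ < _ => replace e with ((w j + V) - (w i + V)) end;
        [exact Hh|].
      unfold w; rewrite !minus_IZR; ring.
Qed.

(** Two Bezout identities, for [a, b] and for their gcd with [c], combine into one for the quotients
    by the common gcd. *)
Lemma primitive_triple (a b c : Z) :
  (a <> 0 \/ b <> 0 \/ c <> 0)%Z ->
  exists g a' b' c' : Z, (0 < g)%Z /\ a = (g * a')%Z /\ b = (g * b')%Z /\ c = (g * c')%Z /\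
    exists u v w, (u * a' + v * b' + w * c' = 1)%Z.
Proof.
  intros H.
  set (h := Z.gcd a b); set (g := Z.gcd h c).
  destruct (Z.gcd_divide_l a b) as (a1 & Ha); destruct (Z.gcd_divide_r a b) as (b1 & Hb).
  destruct (Z.gcd_divide_l h c) as (h1 & Hh); destruct (Z.gcd_divide_r h c) as (c1 & Hc).
  fold h in Ha, Hb; fold g in Hh, Hc.
  destruct (Z.gcd_bezout a b h eq_refl) as (u & v & Hu).
  destruct (Z.gcd_bezout h c g eq_refl) as (s & t & Hs).
  assert (Hg0 : (0 <= g)%Z) by apply Z.gcd_nonneg.
  assert (Hg : g <> 0%Z).
  { intros E; rewrite E in *; rewrite Z.mul_0_r in *; rewrite Hh, Z.mul_0_r in *; lia. }
  exists g, (a1 * h1)%Z, (b1 * h1)%Z, c1.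
  split; [lia|split; [|split; [|split]]]; try nia.
  exists (s * u)%Z, (s * v)%Z, t.
  apply (Z.mul_reg_l _ _ g Hg).
  transitivity (s * (u * (a1 * (h1 * g)) + v * (b1 * (h1 * g))) + t * (c1 * g))%Z; [ring|].
  rewrite <- Hh, <- Ha, <- Hb, <- Hc, Hu, Hs; ring.
Qed.

(** * Flags and non-improvability *)

(** The condition of [DI] at a single scale, which can be refuted at one well-chosen [Q]. *)
Definition improvable (sg Q : R) (v : R * R) : Prop :=
  exists (q : nat) (p1 p2 : Z),
    (1 <= q)%nat /\
    supnorm2 (approx_err v q p1 p2) < sg * / sqrt Q /\
    INR q < sg * Q.

Lemma Rabs_mult_le a b c d : Rabs a <= c -> Rabs b <= d -> Rabs (a * b) <= c * d.
Proof.
  intros H1 H2; rewrite Rabs_mult; apply Rmult_le_compat; auto using Rabs_pos.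
Qed.

(** Two vectors orthogonal to [(A, B, C)] have a cross product parallel to it. Primitivity makes the
    factor an integer: it is the pairing of the cross product with the Bezout coefficients. *)
Lemma cross_product_of_orthogonal (A B C r1 r2 q s1 s2 t v1 v2 v3 : Z) :
  (v1 * A + v2 * B + v3 * C = 1)%Z ->
  (A * r1 + B * r2 + C * q = 0)%Z -> (A * s1 + B * s2 + C * t = 0)%Z ->
  exists j, (s2 * q - t * r2 = j * A /\ t * r1 - s1 * q = j * B /\ s1 * r2 - s2 * r1 = j * C)%Z.
Proof.
  intros Hv Hm Hn.
  set (a := (s2 * q - t * r2)%Z); set (b := (t * r1 - s1 * q)%Z); set (c := (s1 * r2 - s2 * r1)%Z).
  assert (w1 : (a * B = b * A)%Z).
  { apply Z.sub_move_0_r.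
    transitivity (q * (A * s1 + B * s2 + C * t) - t * (A * r1 + B * r2 + C * q))%Z;
      [unfold a, b; ring | rewrite Hm, Hn; ring]. }
  assert (w2 : (a * C = c * A)%Z).
  { apply Z.sub_move_0_r.
    transitivity (s2 * (A * r1 + B * r2 + C * q) - r2 * (A * s1 + B * s2 + C * t))%Z;
      [unfold a, c; ring | rewrite Hm, Hn; ring]. }
  assert (w3 : (b * C = c * B)%Z).
  { apply Z.sub_move_0_r.
    transitivity (r1 * (A * s1 + B * s2 + C * t) - s1 * (A * r1 + B * r2 + C * q))%Z;
      [unfold b, c; ring | rewrite Hm, Hn; ring]. }
  exists (v1 * a + v2 * b + v3 * c)%Z; split; [|split].
  - transitivity (a * (v1 * A + v2 * B + v3 * C))%Z; [rewrite Hv; ring|].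
    transitivity (v1 * a * A + v2 * (a * B) + v3 * (a * C))%Z; [ring|rewrite w1, w2; ring].
  - transitivity (b * (v1 * A + v2 * B + v3 * C))%Z; [rewrite Hv; ring|].
    transitivity (v1 * (b * A) + v2 * b * B + v3 * (b * C))%Z; [ring|rewrite <- w1, w3; ring].
  - transitivity (c * (v1 * A + v2 * B + v3 * C))%Z; [rewrite Hv; ring|].
    transitivity (v1 * (c * A) + v2 * (c * B) + v3 * c * C)%Z; [ring|rewrite <- w2, <- w3; ring].
Qed.

(* The flag [m] in [d^perp] puts the lattice of [(x, y)] at scale [Q] near a critical lattice of
   the cube: any point of the box lies in [d^perp] since its pairing with [d] is an integer of
   absolute value below 1, then on the line of [m] since its cross product with [m] is a multiple
   of [d] that is too short, and the nonzero multiples of [m] are outside the box. *)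
Lemma flag_not_improvable (sg ka ep x y Q : R) (r1 r2 q A B C u1 u2 u3 v1 v2 v3 : Z) :
  0 < Q -> 0 < sg < 1 -> 0 <= ka -> sg * (1 + ka) + 2 * ep <= 1 -> sg * (1 + ka) < 1 ->
  (u1 * r1 + u2 * r2 + u3 * q = 1)%Z ->
  (v1 * A + v2 * B + v3 * C = 1)%Z ->
  (A * r1 + B * r2 + C * q = 0)%Z ->
  Rabs (IZR A) <= ep * sqrt Q -> Rabs (IZR B) <= ep * sqrt Q ->
  1 <= Q * (IZR C - IZR A * x - IZR B * y) <= 1 + ka ->
  sg <= Rabs (IZR q * y + IZR r2) * sqrt Q ->
  (Rabs (IZR q * x + IZR r1) + Rabs (IZR q * y + IZR r2)) * sqrt Q <= 1 + ka ->
  ~ improvable sg Q (x, y).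
Proof.
  intros HQ Hsg Hka Hep Hsk Hu Hv Hmd HA HB He HY HXY (h & p1 & p2 & Hh & Hn & HhQ).
  set (s := sqrt Q) in *.
  assert (Hs : 0 < s) by (apply sqrt_lt_R0; exact HQ).
  assert (Hss : s * s = Q) by (apply sqrt_sqrt; lra).
  set (s1 := (- p1)%Z); set (s2 := (- p2)%Z); set (t := Z.of_nat h).
  set (e := IZR C - IZR A * x - IZR B * y) in *.
  set (Xm := IZR q * x + IZR r1) in *; set (Ym := IZR q * y + IZR r2) in *.
  set (Xn := IZR t * x + IZR s1); set (Yn := IZR t * y + IZR s2).
  assert (Hn' : Rabs Xn < sg * / s /\ Rabs Yn < sg * / s).
  { unfold supnorm2, approx_err in Hn; simpl in Hn.
    unfold Xn, Yn, s1, s2, t; rewrite !opp_IZR, <- INR_IZR_INZ.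
    split; [eapply Rle_lt_trans; [apply Rmax_l|exact Hn] |
            eapply Rle_lt_trans; [apply Rmax_r|exact Hn]]. }
  destruct Hn' as [HXn HYn].
  assert (His : 0 < / s) by (apply Rinv_0_lt_compat; exact Hs).
  assert (Hsi : s * / s = 1) by (field; lra).
  assert (Hep0 : 0 <= ep) by (assert (h0 := Rabs_pos (IZR A)); nra).
  assert (Ht : 0 < IZR t) by (unfold t; rewrite <- INR_IZR_INZ; apply lt_0_INR; lia).
  assert (HtQ : IZR t < sg * Q) by (unfold t; rewrite <- INR_IZR_INZ; exact HhQ).
  assert (Hdn : (A * s1 + B * s2 + C * t = 0)%Z).
  { apply IZR_small_zero.
    replace (IZR (A * s1 + B * s2 + C * t)) with (IZR A * Xn + IZR B * Yn + IZR t * e)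
      by (unfold Xn, Yn, e; rewrite !plus_IZR, !mult_IZR; ring).
    assert (h1 : Rabs (IZR A * Xn) <= ep * s * (sg * / s)) by (apply Rabs_mult_le; lra).
    assert (h2 : Rabs (IZR B * Yn) <= ep * s * (sg * / s)) by (apply Rabs_mult_le; lra).
    assert (h3 : ep * s * (sg * / s) = ep * sg)
      by (transitivity (ep * sg * (s * / s)); [ring | rewrite Hsi; ring]).
    rewrite h3 in h1, h2.
    assert (h4 : 0 < IZR t * e < sg * (1 + ka)).
    { assert (0 < e) by nra.
      split; [apply Rmult_lt_0_compat; auto|].
      apply Rlt_le_trans with (sg * Q * e); [apply Rmult_lt_compat_r; auto|].
      rewrite Rmult_assoc; apply Rmult_le_compat_l; lra. }
    assert (h5 : ep * sg <= ep) by nra.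
    assert (h6 := Rabs_triang (IZR A * Xn) (IZR B * Yn)).
    assert (h7 : Rabs (IZR A * Xn + IZR B * Yn) <= 2 * (ep * sg)) by lra.
    assert (h8 := Rle_abs (IZR A * Xn + IZR B * Yn)).
    assert (h9 := Rle_abs (- (IZR A * Xn + IZR B * Yn))); rewrite Rabs_Ropp in h9.
    apply Rabs_def1; nra. }
  destruct (cross_product_of_orthogonal A B C r1 r2 q s1 s2 t v1 v2 v3 Hv Hmd Hdn)
    as (j & Hj1 & Hj2 & Hj3).
  assert (Hj : j = 0%Z).
  { apply IZR_small_zero.
    (* Pairing the cross product with [(-x, -y, 1)] gives [j * e] on one side and the determinant of
       the two error vectors on the other. Times [Q] this is below 1, whereas [Q * e >= 1]. *)
    assert (Hje : IZR j * e = Xn * Ym - Yn * Xm).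
    { apply (f_equal IZR) in Hj1, Hj2, Hj3.
      rewrite minus_IZR, !mult_IZR in Hj1, Hj2, Hj3.
      unfold e; replace (IZR j * (IZR C - IZR A * x - IZR B * y))
        with (IZR j * IZR C - IZR j * IZR A * x - IZR j * IZR B * y) by ring.
      rewrite <- Hj1, <- Hj2, <- Hj3; unfold Xn, Ym, Yn, Xm; ring. }
    assert (h1 : Rabs (IZR j * e) <= sg * / s * (Rabs Xm + Rabs Ym)).
    { rewrite Hje; unfold Rminus; eapply Rle_trans; [apply Rabs_triang|].
      rewrite Rabs_Ropp, !Rabs_mult.
      assert (p3 := Rabs_pos Xm); assert (p4 := Rabs_pos Ym); nra. }
    assert (h2 : Rabs (IZR j * e) * Q < 1).
    { apply Rle_lt_trans with (sg * ((Rabs Xm + Rabs Ym) * s)); [|nra].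
      apply Rle_trans with (sg * / s * (Rabs Xm + Rabs Ym) * Q);
        [apply Rmult_le_compat_r; lra|].
      right; rewrite <- Hss.
      transitivity (sg * ((Rabs Xm + Rabs Ym) * s) * (s * / s)); [ring | rewrite Hsi; ring]. }
    assert (he : 0 < e) by nra.
    rewrite Rabs_mult, (Rabs_right e) in h2 by lra.
    assert (p := Rabs_pos (IZR j)); nra. }
  rewrite Hj in Hj1, Hj2, Hj3.
  (* The cross product vanishes, so the point is a multiple of the primitive [m]; pairing with the
     Bezout coefficients of [m] reads off the factor. *)
  set (i := (u1 * s1 + u2 * s2 + u3 * t)%Z).
  assert (Hi2 : (s2 = i * r2)%Z).
  { transitivity (s2 * (u1 * r1 + u2 * r2 + u3 * q))%Z; [rewrite Hu; ring|].
    transitivity (u1 * (s2 * r1) + u2 * s2 * r2 + u3 * (s2 * q))%Z; [ring|].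
    replace (s2 * r1)%Z with (s1 * r2)%Z by lia; replace (s2 * q)%Z with (t * r2)%Z by lia.
    unfold i; ring. }
  assert (Hi3 : (t = i * q)%Z).
  { transitivity (t * (u1 * r1 + u2 * r2 + u3 * q))%Z; [rewrite Hu; ring|].
    transitivity (u1 * (t * r1) + u2 * (t * r2) + u3 * t * q)%Z; [ring|].
    replace (t * r1)%Z with (s1 * q)%Z by lia; replace (t * r2)%Z with (s2 * q)%Z by lia.
    unfold i; ring. }
  assert (Hi : i <> 0%Z) by (intros E; rewrite E in Hi3; simpl in Hi3; rewrite Hi3 in Ht; lra).
  assert (HYY : Yn = IZR i * Ym).
  { unfold Yn, Ym; rewrite Hi2, Hi3, !mult_IZR; ring. }
  rewrite HYY, Rabs_mult in HYn.
  assert (h1 := IZR_Rabs_ge_1 i Hi); assert (h2 := Rabs_pos Ym).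
  assert (h3 : Rabs Ym < sg * / s) by nra.
  assert (h4 : Rabs Ym * s < sg * (s * / s)) by nra.
  rewrite Hsi in h4; lra.
Qed.

(** * Construction of flags *)

(* The rational line [A x + B y = C] passes close to the point [(x, al * x + be)]: the third
   form below is [C - A x - B y] there. *)
Definition near_rational_line (al be P1 P2 P3 S x : R) : Prop :=
  exists A B C : Z, (A <> 0 \/ B <> 0)%Z /\
    Rabs (IZR A + al * IZR B) <= P1 * S /\ Rabs (IZR B) <= P2 * S /\
    Rabs (IZR C - (IZR A + al * IZR B) * x - IZR B * be) < P3 / S ^ 2.

(** Orthogonality of [d] and [m] in coordinates adapted to the line: [phi * X + B * l + q * e = 0].
    It converts bounds for two of the terms into a bound for the third. *)
Lemma pairing_identity (al be x : R) (r1 r2 q A B C : Z) :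
  (A * r1 + B * r2 + C * q = 0)%Z ->
  (IZR A + al * IZR B) * (IZR q * x + IZR r1) +
    IZR B * (IZR q * be - al * IZR r1 + IZR r2) =
  - (IZR q * (IZR C - (IZR A + al * IZR B) * x - IZR B * be)).
Proof.
  intros H; apply (f_equal IZR) in H; rewrite !plus_IZR, !mult_IZR in H; nra.
Qed.

(** With [S = k * n], the bin numbers [n = S / k] and [k * k * n = k * S] have product [S ^ 2], so
    precision is shifted from [X] to [l]. Dividing by the gcd preserves the bounds. *)
Lemma primitive_approximation (al be x : R) (k n : nat) :
  (0 < k)%nat -> (0 < n)%nat ->
  exists r1 r2 q u1 u2 u3 : Z, (u1 * r1 + u2 * r2 + u3 * q = 1)%Z /\ (0 < q)%Z /\
    IZR q <= INR (k * n) ^ 2 /\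
    Rabs (IZR q * x + IZR r1) * INR (k * n) <= INR k /\
    Rabs (IZR q * be - al * IZR r1 + IZR r2) * (INR k * INR (k * n)) <= 1.
Proof.
  intros Hk Hn.
  destruct (simultaneous_dirichlet x al be n (k * k * n)) as (q & r1 & r2 & Hq & HX & Hl); [lia|nia|].
  destruct (primitive_triple r1 r2 q) as (g & r1' & r2' & q' & Hg & -> & -> & -> & u1 & u2 & u3 & Hu);
    [lia|].
  exists r1', r2', q', u1, u2, u3.
  assert (Hq' : (0 < q')%Z) by nia.
  assert (Hg1 : 1 <= IZR g) by (apply IZR_le; lia).
  assert (Hk0 : 0 < INR k) by (apply lt_0_INR; exact Hk).
  assert (Hn0 : 0 < INR n) by (apply lt_0_INR; exact Hn).
  rewrite !mult_IZR in HX; rewrite !mult_IZR in Hl; rewrite !mult_INR in *.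
  split; [exact Hu|split; [exact Hq'|split; [|split]]].
  - assert (h : (q' <= Z.of_nat (n * (k * k * n)))%Z) by nia.
    apply IZR_le in h; rewrite <- INR_IZR_INZ, !mult_INR in h; nra.
  - replace (IZR g * IZR q' * x + IZR g * IZR r1') with (IZR g * (IZR q' * x + IZR r1')) in HX by ring.
    rewrite Rabs_mult, (Rabs_right (IZR g)) in HX by lra.
    assert (p := Rabs_pos (IZR q' * x + IZR r1')).
    assert (Rabs (IZR q' * x + IZR r1') * INR n <= 1) by nra.
    nra.
  - replace (IZR g * IZR q' * be - al * (IZR g * IZR r1') + IZR g * IZR r2')
      with (IZR g * (IZR q' * be - al * IZR r1' + IZR r2')) in Hl by ring.
    rewrite Rabs_mult, (Rabs_right (IZR g)) in Hl by lra.
    set (y := Rabs (IZR q' * be - al * IZR r1' + IZR r2')) in *.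
    assert (p : 0 <= y) by apply Rabs_pos.
    assert (0 <= y * (INR k * INR k * INR n)) by (apply Rmult_le_pos; nra).
    nra.
Qed.

(** If [q] is small against [S ^ 2], a box of side about [s0 * S] holds far more points than there
    are residues modulo [q]. The surplus pays for bins of the form [q * e], and the resulting
    orthogonal vector is a rational line too close to [x]. *)
Lemma denominator_lower_bound (al be x k S s0 : R) (r1 r2 q : Z) :
  1 <= k -> 0 < s0 -> 1 <= s0 * S -> 0 < S -> (0 < q)%Z ->
  Rabs (IZR q * x + IZR r1) * S <= k ->
  Rabs (IZR q * be - al * IZR r1 + IZR r2) * (k * S) <= 1 ->
  ~ near_rational_line al be (2 * s0) (2 * s0) (18 * k / s0) S x ->
  s0 ^ 2 / 2 * S ^ 2 <= IZR q.
Proof.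
  intros Hk Hs0 Hs0S HS Hq HX Hl Hno.
  destruct (Rle_lt_dec (s0 ^ 2 / 2 * S ^ 2) (IZR q)) as [h|h]; [exact h|exfalso; apply Hno; clear Hno].
  assert (Hq1 : 1 <= IZR q) by (apply IZR_le; lia).
  set (X := IZR q * x + IZR r1) in *; set (l := IZR q * be - al * IZR r1 + IZR r2) in *.
  assert (pX := Rabs_pos X); assert (pl := Rabs_pos l).
  destruct (exists_nat_ceil (s0 * S)) as (s & Hs); [lra|].
  assert (Hb0 : 0 <= s0 ^ 2 * S ^ 2 / (2 * IZR q)).
  { apply Rmult_le_pos; [nra | left; apply Rinv_0_lt_compat; lra]. }
  (* This makes [q * b] exceed half of [s0 ^ 2 * S ^ 2] while keeping it below [s * s], as the
     pigeonhole principle requires. *)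
  destruct (exists_nat_ceil (s0 ^ 2 * S ^ 2 / (2 * IZR q)) Hb0) as (b & Hb).
  assert (Hqb : s0 ^ 2 * S ^ 2 / 2 < IZR q * INR b <= s0 ^ 2 * S ^ 2 / 2 + IZR q).
  { replace (s0 ^ 2 * S ^ 2 / 2) with (IZR q * (s0 ^ 2 * S ^ 2 / (2 * IZR q))) by (field; lra).
    split; nra. }
  destruct (orthogonal_dirichlet al X l (9 * s0 * k) r1 r2 q s s b)
    as (A & B & C & HAB & Hort & HA & HB & Hw).
  - exact Hq.
  - apply INR_lt; simpl; lra.
  - apply lt_IZR; rewrite mult_IZR, <- !INR_IZR_INZ, mult_INR; nra.
  - assert (Rabs X * INR s <= 2 * s0 * k) by nra.
    assert (Rabs l * S <= 1) by nra.
    assert (Rabs l * INR s <= 2 * s0) by nra.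
    nra.
  - assert (He := pairing_identity al be x r1 r2 q A B C Hort); fold X l in He.
    rewrite He, Rabs_Ropp, Rabs_mult, (Rabs_right (IZR q)) in Hw by lra.
    exists A, B, C; split; [exact HAB|split; [|split]]; [nra|nra|].
    set (e := Rabs (IZR C - (IZR A + al * IZR B) * x - IZR B * be)) in *.
    assert (pe : 0 <= e) by apply Rabs_pos.
    assert (HS2 : 0 < S ^ 2) by nra.
    apply (Rmult_lt_reg_r (s0 * S ^ 2 / 2)); [apply Rmult_lt_0_compat; nra|].
    replace (18 * k / s0 / S ^ 2 * (s0 * S ^ 2 / 2)) with (9 * k) by (field; lra).
    apply (Rmult_lt_reg_l s0); [exact Hs0|].
    apply Rle_lt_trans with (IZR q * e * INR b); [|lra].
    replace (s0 * (e * (s0 * S ^ 2 / 2))) with (e * (s0 ^ 2 * S ^ 2 / 2)) by field.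
    nra.
Qed.

Lemma orthogonal_in_box (al : R) (r1 r2 q : Z) (u : R) :
  (0 < q)%Z -> 1 <= u ->
  exists A B C : Z, (A <> 0 \/ B <> 0)%Z /\ (A * r1 + B * r2 + C * q = 0)%Z /\
    Rabs (IZR A + al * IZR B) <= 2 * u /\ Rabs (IZR B) <= IZR q / u.
Proof.
  intros Hq Hu.
  assert (Hq1 : 1 <= IZR q) by (apply IZR_le; lia).
  destruct (exists_nat_ceil u) as (nu & Hnu); [lra|].
  assert (Hqu : 0 <= IZR q / INR nu).
  { apply Rmult_le_pos; [lra | left; apply Rinv_0_lt_compat; lra]. }
  destruct (exists_nat_ceil _ Hqu) as (nt & Hnt).
  assert (Hqn : IZR q = IZR q / INR nu * INR nu) by (field; lra).
  (* With zero forms and a single bin only the residue modulo [q] counts. *)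
  destruct (orthogonal_dirichlet al 0 0 1 r1 r2 q nu nt 1) as (A & B & C & HAB & Hort & HA & HB & _).
  - exact Hq.
  - lia.
  - apply lt_IZR; rewrite mult_IZR, <- !INR_IZR_INZ, mult_INR; simpl; nra.
  - rewrite Rabs_R0; lra.
  - exists A, B, C; split; [exact HAB|split; [exact Hort|split]]; [lra|].
    apply Rle_trans with (IZR q / INR nu); [lra|].
    apply Rmult_le_compat_l; [lra|]; apply Rinv_le_contravar; lra.
Qed.

(** There is an orthogonal vector with [|phi| <= c * S] and [|B| <= 2 / c * S]. Were [l] smaller
    than claimed, the pairing identity would give [q * |e| <= (1 + 2 / 3) * c * k], placing [x] near
    a rational line. *)
Lemma transversal_lower_bound (al be x k S c z0 : R) (r1 r2 q : Z) :
  1 <= k -> 0 < c -> 2 <= c * S -> 0 < S -> 0 < z0 -> (0 < q)%Z ->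
  z0 * S ^ 2 <= IZR q <= S ^ 2 ->
  Rabs (IZR q * x + IZR r1) * S <= k ->
  ~ near_rational_line al be c (2 / c) (2 * c * k / z0) S x ->
  c ^ 2 * k / 3 <= Rabs (IZR q * be - al * IZR r1 + IZR r2) * S.
Proof.
  intros Hk Hc HcS HS Hz0 Hq Hqz HX Hno.
  set (X := IZR q * x + IZR r1) in *; set (l := IZR q * be - al * IZR r1 + IZR r2) in *.
  destruct (Rle_lt_dec (c ^ 2 * k / 3) (Rabs l * S)) as [h|h]; [exact h|exfalso; apply Hno; clear Hno].
  assert (pX := Rabs_pos X); assert (pl := Rabs_pos l).
  destruct (orthogonal_in_box al r1 r2 q (c * S / 2) Hq) as (A & B & C & HAB & Hort & HA & HB); [lra|].
  assert (He := pairing_identity al be x r1 r2 q A B C Hort); fold X l in He.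
  assert (HB' : Rabs (IZR B) <= 2 / c * S).
  { eapply Rle_trans; [exact HB|].
    replace (2 / c * S) with (S ^ 2 / (c * S / 2)) by (field; lra).
    apply Rmult_le_compat_r; [left; apply Rinv_0_lt_compat|]; lra. }
  exists A, B, C; split; [exact HAB|split; [lra|split; [exact HB'|]]].
  set (phi := IZR A + al * IZR B) in *.
  set (e := IZR C - phi * x - IZR B * be) in *.
  assert (pe := Rabs_pos e); assert (pp := Rabs_pos phi); assert (pB := Rabs_pos (IZR B)).
  assert (Hqe : IZR q * Rabs e <= Rabs phi * Rabs X + Rabs (IZR B) * Rabs l).
  { rewrite <- (Rabs_right (IZR q)), <- Rabs_mult, <- Rabs_Ropp, <- He, <- !Rabs_mult by nra.
    apply Rabs_triang. }
  assert (h1 : Rabs phi * Rabs X <= c * k) by nra.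
  assert (h2 : Rabs (IZR B) * Rabs l <= 2 / c * (c ^ 2 * k / 3)).
  { apply Rle_trans with (2 / c * S * Rabs l); [nra|].
    assert (0 < 2 / c) by (apply Rdiv_lt_0_compat; lra).
    rewrite Rmult_assoc; apply Rmult_le_compat_l; lra. }
  replace (2 / c * (c ^ 2 * k / 3)) with (2 / 3 * (c * k)) in h2 by (field; lra).
  assert (HS2 : 0 < S ^ 2) by nra.
  apply (Rmult_lt_reg_r (z0 * S ^ 2)); [nra|].
  replace (2 * c * k / z0 / S ^ 2 * (z0 * S ^ 2)) with (2 * (c * k)) by (field; lra).
  assert (0 < c * k) by nra.
  assert (Rabs e * (z0 * S ^ 2) <= IZR q * Rabs e) by nra.
  lra.
Qed.

(** The gain is that [B] is smaller than [phi] by a factor of order [ep]. If the lower bound for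
    [phi] failed, [phi] and [B] would both be at most [3 / (ep ^ 2 * k) * (q / S)], and the pairing
    identity would place [x] near a rational line. *)
Lemma primitive_orthogonal (al be x k S ep : R) (r1 r2 q : Z) :
  1 <= k -> 0 < ep <= 1 -> 1 <= ep * k * S -> 0 < S -> (0 < q)%Z -> IZR q <= S ^ 2 ->
  Rabs (IZR q * x + IZR r1) * S <= k ->
  Rabs (IZR q * be - al * IZR r1 + IZR r2) * (k * S) <= 1 ->
  ~ near_rational_line al be (3 / (ep ^ 2 * k)) (3 / (ep ^ 2 * k)) (9 / ep ^ 2) S x ->
  exists A B C v1 v2 v3 : Z, (v1 * A + v2 * B + v3 * C = 1)%Z /\
    (A * r1 + B * r2 + C * q = 0)%Z /\
    Rabs (IZR B) * (ep * k * S) <= IZR q /\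
    3 * IZR q <= Rabs (IZR A + al * IZR B) * (ep ^ 2 * k * S) /\
    Rabs (IZR A + al * IZR B) <= 2 * (ep * k * S).
Proof.
  intros Hk Hep HkS HS Hq HqS HX Hl Hno.
  destruct (orthogonal_in_box al r1 r2 q (ep * k * S) Hq HkS)
    as (A' & B' & C' & HAB & Hort & HA & HB).
  destruct (primitive_triple A' B' C') as (g & A & B & C & Hg & EA & EB & EC & v1 & v2 & v3 & Hv);
    [tauto|].
  subst A' B' C'.
  assert (Hg1 : 1 <= IZR g) by (apply IZR_le; lia).
  assert (Hq1 : 1 <= IZR q) by (apply IZR_le; lia).
  assert (Hort' : (A * r1 + B * r2 + C * q = 0)%Z) by nia.
  set (phi := IZR A + al * IZR B).
  assert (HA' : Rabs phi <= 2 * (ep * k * S)).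
  { rewrite !mult_IZR in HA.
    replace (IZR g * IZR A + al * (IZR g * IZR B)) with (IZR g * phi) in HA by (unfold phi; ring).
    rewrite Rabs_mult, (Rabs_right (IZR g)) in HA by lra.
    assert (p := Rabs_pos phi); nra. }
  assert (HB' : Rabs (IZR B) * (ep * k * S) <= IZR q).
  { rewrite mult_IZR, Rabs_mult, (Rabs_right (IZR g)) in HB by lra.
    assert (p := Rabs_pos (IZR B)).
    replace (IZR q) with (IZR q / (ep * k * S) * (ep * k * S)) by (field; lra).
    apply Rmult_le_compat_r; [lra|]; nra. }
  exists A, B, C, v1, v2, v3; split; [exact Hv|split; [exact Hort'|split; [exact HB'|split; [|exact HA']]]].
  destruct (Rle_lt_dec (3 * IZR q) (Rabs phi * (ep ^ 2 * k * S))) as [h|h]; [exact h|].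
  exfalso; apply Hno.
  assert (Hek : 0 < ep ^ 2 * k) by (apply Rmult_lt_0_compat; nra).
  assert (Hphi : Rabs phi <= 3 / (ep ^ 2 * k) * (IZR q / S)).
  { apply (Rmult_le_reg_r (ep ^ 2 * k * S)); [nra|].
    replace (3 / (ep ^ 2 * k) * (IZR q / S) * (ep ^ 2 * k * S)) with (3 * IZR q) by (field; lra).
    lra. }
  assert (HBn : Rabs (IZR B) <= 3 / (ep ^ 2 * k) * (IZR q / S)).
  { apply (Rmult_le_reg_r (ep * k * S)); [lra|].
    replace (3 / (ep ^ 2 * k) * (IZR q / S) * (ep * k * S)) with (3 / ep * IZR q) by (field; lra).
    assert (1 <= 3 / ep).
    { apply (Rmult_le_reg_r ep); [lra|]; replace (3 / ep * ep) with 3 by (field; lra); lra. }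
    nra. }
  assert (Hnu : 0 < 3 / (ep ^ 2 * k)) by (apply Rdiv_lt_0_compat; lra).
  assert (HqS' : IZR q / S <= S).
  { apply (Rmult_le_reg_r S); [exact HS|]; replace (IZR q / S * S) with (IZR q) by (field; lra); nra. }
  exists A, B, C; split; [|split; [|split]].
  - destruct HAB as [h0|h0]; [left|right]; intros E; apply h0; rewrite E; ring.
  - fold phi; nra.
  - nra.
  - fold phi.
    assert (He := pairing_identity al be x r1 r2 q A B C Hort').
    fold phi in He.
    set (X := IZR q * x + IZR r1) in *; set (l := IZR q * be - al * IZR r1 + IZR r2) in *.
    set (e := IZR C - phi * x - IZR B * be) in *.
    assert (Hqe : IZR q * Rabs e <= Rabs phi * Rabs X + Rabs (IZR B) * Rabs l).
    { rewrite <- (Rabs_right (IZR q)), <- Rabs_mult, <- Rabs_Ropp, <- He, <- !Rabs_mult by nra.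
      apply Rabs_triang. }
    assert (pX := Rabs_pos X); assert (pl := Rabs_pos l); assert (pe := Rabs_pos e).
    set (nu := 3 / (ep ^ 2 * k)) in *.
    assert (HlS : Rabs l * S <= 1) by nra.
    assert (Hb : IZR q * Rabs e <= nu * (IZR q / S) * (Rabs X + Rabs l)) by nra.
    assert (Hb2 : IZR q * (Rabs e * S ^ 2) <= IZR q * (nu * (k + 1))).
    { apply Rle_trans with (nu * (IZR q / S) * (Rabs X + Rabs l) * S ^ 2).
      - replace (IZR q * (Rabs e * S ^ 2)) with (IZR q * Rabs e * S ^ 2) by ring.
        apply Rmult_le_compat_r; nra.
      - replace (nu * (IZR q / S) * (Rabs X + Rabs l) * S ^ 2)
          with (IZR q * (nu * (Rabs X * S + Rabs l * S))) by (field; lra).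
        apply Rmult_le_compat_l; [lra|]; apply Rmult_le_compat_l; lra. }
    apply Rmult_le_reg_l in Hb2; [|lra].
    assert (HS2 : 0 < S ^ 2) by nra.
    apply (Rmult_lt_reg_r (S ^ 2)); [exact HS2|].
    replace (9 / ep ^ 2 / S ^ 2 * S ^ 2) with (3 * nu * k) by (unfold nu; field; lra).
    nra.
Qed.

(** * Windows of non-improvable points *)

Lemma linear_window (f p lo hi : R) : p <> 0 -> lo <= hi ->
  exists w, forall x, w <= x <= w + (hi - lo) / Rabs p -> lo <= f - p * x <= hi.
Proof.
  intros Hp Hlh.
  destruct (Rlt_le_dec 0 p) as [h|h].
  - exists ((f - hi) / p); intros x Hx; rewrite Rabs_right in Hx by lra.
    replace ((f - hi) / p + (hi - lo) / p) with ((f - lo) / p) in Hx by (field; lra).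
    destruct Hx as [h1 h2].
    apply (Rmult_le_compat_r p) in h1, h2; [|lra|lra].
    replace ((f - hi) / p * p) with (f - hi) in h1 by (field; lra).
    replace ((f - lo) / p * p) with (f - lo) in h2 by (field; lra).
    lra.
  - exists ((f - lo) / p); intros x Hx; rewrite Rabs_left in Hx by lra.
    replace ((f - lo) / p + (hi - lo) / - p) with ((f - hi) / p) in Hx by (field; lra).
    destruct Hx as [h1 h2].
    apply (Rmult_le_compat_r (- p)) in h1, h2; [|lra|lra].
    replace ((f - lo) / p * - p) with (- (f - lo)) in h1 by (field; lra).
    replace ((f - hi) / p * - p) with (- (f - hi)) in h2 by (field; lra).
    lra.
Qed.

(** The scale [Q = / l ^ 2] normalizes [l] to absolute value 1. The window is where
    [1 <= Q * e(x') <= 2 - sg]; as [e] has slope [- phi], its length is [(1 - sg) * l ^ 2 / |phi|].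
    Because [B] is small relative to [phi], the pairing identity forces [|X| <= ep * |l|] there, so
    the renormalized [m] is near the second axis. *)
Lemma flag_window (al be x sg ep k S : R) (r1 r2 q A B C u1 u2 u3 v1 v2 v3 : Z) :
  0 < sg < 1 -> 0 < ep -> 2 * ((2 + Rabs al) * ep) <= (1 - sg) ^ 2 ->
  1 <= k -> 1 <= ep * k -> 0 < S -> (0 < q)%Z -> IZR q <= S ^ 2 ->
  IZR q * be - al * IZR r1 + IZR r2 <> 0 ->
  Rabs (IZR q * be - al * IZR r1 + IZR r2) * (k * S) <= 1 ->
  (u1 * r1 + u2 * r2 + u3 * q = 1)%Z ->
  (v1 * A + v2 * B + v3 * C = 1)%Z ->
  (A * r1 + B * r2 + C * q = 0)%Z ->
  Rabs (IZR B) * (ep * k * S) <= IZR q ->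
  3 * IZR q <= Rabs (IZR A + al * IZR B) * (ep ^ 2 * k * S) ->
  Rabs (IZR A + al * IZR B) <= 2 * (ep * k * S) ->
  exists w,
    IZR q * Rabs (w - x) <= Rabs (IZR q * x + IZR r1)
      + ep * Rabs (IZR q * be - al * IZR r1 + IZR r2) /\
    forall x', w <= x' <= w + (1 - sg) * (IZR q * be - al * IZR r1 + IZR r2) ^ 2
                                / Rabs (IZR A + al * IZR B) ->
      ~ improvable sg (/ (IZR q * be - al * IZR r1 + IZR r2) ^ 2) (x', al * x' + be).
Proof.
  intros Hsg Hep Hep2 Hk Hek HS Hq HqS Hl0 Hl Hu Hv Hort HB Hphi HphiS.
  assert (Hq1 : 1 <= IZR q) by (apply IZR_le; lia).
  set (l := IZR q * be - al * IZR r1 + IZR r2) in *.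
  set (phi := IZR A + al * IZR B) in *.
  set (f := IZR C - IZR B * be).
  assert (pal := Rabs_pos al).
  assert (Hl2 : 0 < Rabs l) by (apply Rabs_pos_lt; exact Hl0).
  assert (Hll : l ^ 2 = Rabs l * Rabs l) by (rewrite <- Rabs_mult, Rabs_right; [ring | nra]).
  assert (Hphi0 : 0 < Rabs phi).
  { assert (0 < ep ^ 2 * k * S) by (repeat apply Rmult_lt_0_compat; lra).
    destruct (Rle_lt_dec (Rabs phi) 0) as [h|h]; [nra | exact h]. }
  assert (Hphin : phi <> 0) by (intros E; rewrite E, Rabs_R0 in Hphi0; lra).
  assert (Hkey : forall x', l ^ 2 <= f - phi * x' <= (2 - sg) * l ^ 2 ->
    Rabs (IZR q * x' + IZR r1) <= ep * Rabs l).
  { intros x' Hx'.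
    assert (He := pairing_identity al be x' r1 r2 q A B C Hort).
    fold phi l in He.
    replace (IZR C - phi * x' - IZR B * be) with (f - phi * x') in He by (unfold f; ring).
    set (X := IZR q * x' + IZR r1) in *.
    assert (h1 : Rabs phi * Rabs X <= Rabs (IZR B) * Rabs l + IZR q * ((2 - sg) * l ^ 2)).
    { rewrite <- !Rabs_mult.
      replace (phi * X) with (- (IZR B * l) + - (IZR q * (f - phi * x'))) by lra.
      eapply Rle_trans; [apply Rabs_triang|]; rewrite !Rabs_Ropp.
      apply Rplus_le_compat_l; rewrite Rabs_right by nra.
      apply Rmult_le_compat_l; lra. }
    assert (Hekl : Rabs l * (ep * k * S) <= ep) by nra.
    assert (h2 : Rabs phi * Rabs X * (ep * k * S) <= 3 * IZR q * Rabs l).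
    { assert (0 < ep * k * S) by nra.
      apply Rle_trans with ((Rabs (IZR B) * Rabs l + IZR q * ((2 - sg) * l ^ 2)) * (ep * k * S));
        [apply Rmult_le_compat_r; lra|].
      assert (a1 : Rabs (IZR B) * Rabs l * (ep * k * S) <= IZR q * Rabs l) by nra.
      assert (a2 : IZR q * ((2 - sg) * l ^ 2) * (ep * k * S) <= IZR q * Rabs l * ((2 - sg) * ep)).
      { rewrite Hll.
        replace (IZR q * ((2 - sg) * (Rabs l * Rabs l)) * (ep * k * S))
          with (IZR q * Rabs l * ((2 - sg) * (Rabs l * (ep * k * S)))) by ring.
        apply Rmult_le_compat_l; [nra|]; apply Rmult_le_compat_l; lra. }
      assert (a3 : (2 - sg) * ep <= 2) by nra.
      assert (a4 : 0 < IZR q * Rabs l) by nra.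
      nra. }
    assert (h3 : Rabs phi * (ep * k * S) * Rabs X <= Rabs phi * (ep * k * S) * (ep * Rabs l)) by nra.
    apply Rmult_le_reg_l in h3; [exact h3|]; nra. }
  destruct (linear_window f phi (l ^ 2) ((2 - sg) * l ^ 2)) as (w & Hw); [exact Hphin | nra |].
  replace (((2 - sg) * l ^ 2 - l ^ 2) / Rabs phi) with ((1 - sg) * l ^ 2 / Rabs phi) in Hw
    by (field; lra).
  exists w; split.
  - assert (Hw0 : 0 <= (1 - sg) * l ^ 2 / Rabs phi).
    { apply Rmult_le_pos; [nra | left; apply Rinv_0_lt_compat; lra]. }
    assert (h := Hkey w (Hw w ltac:(lra))).
    rewrite <- (Rabs_right (IZR q)) at 1 by lra; rewrite <- Rabs_mult.
    replace (IZR q * (w - x)) with ((IZR q * w + IZR r1) - (IZR q * x + IZR r1)) by ring.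
    unfold Rminus; eapply Rle_trans; [apply Rabs_triang|]; rewrite Rabs_Ropp; lra.
  - intros x' Hx'; specialize (Hw x' Hx'); specialize (Hkey x' Hw).
    set (X := IZR q * x' + IZR r1) in *.
    assert (Hsq : sqrt (/ l ^ 2) = / Rabs l).
    { rewrite Hll, Rinv_mult; apply sqrt_square; left; apply Rinv_0_lt_compat; exact Hl2. }
    assert (HY : IZR q * (al * x' + be) + IZR r2 = l + al * X) by (unfold l, X; ring).
    assert (Hil : 0 < / Rabs l) by (apply Rinv_0_lt_compat; exact Hl2).
    assert (Hill : Rabs l * / Rabs l = 1) by (field; lra).
    assert (HalX : Rabs (al * X) <= Rabs al * (ep * Rabs l)).
    { rewrite Rabs_mult; apply Rmult_le_compat_l; lra. }
    assert (Hb : forall t c, t <= c * Rabs l -> t * / Rabs l <= c).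
    { intros t c h; apply (Rmult_le_reg_r (Rabs l)); [exact Hl2|].
      rewrite Rmult_assoc, (Rmult_comm (/ Rabs l)), Hill; lra. }
    assert (Hekl : Rabs l * (ep * k * S) <= ep) by nra.
    assert (HSl : k * S <= / Rabs l).
    { apply (Rmult_le_reg_r (Rabs l)); [exact Hl2|]; rewrite (Rmult_comm (/ Rabs l)), Hill; lra. }
    assert (HBb : Rabs (IZR B) <= ep * / Rabs l).
    { apply Rle_trans with S.
      - apply (Rmult_le_reg_r (ep * k * S)); [nra|].
        apply Rle_trans with (IZR q); [lra|]; nra.
      - assert (ep * (k * S) <= ep * / Rabs l) by (apply Rmult_le_compat_l; lra); nra. }
    assert (Hpb : Rabs phi <= 2 * ep * / Rabs l) by nra.
    assert (HAb : Rabs (IZR A) <= (2 + Rabs al) * ep * / Rabs l).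
    { replace (IZR A) with (phi + - (al * IZR B)) by (unfold phi; ring).
      eapply Rle_trans; [apply Rabs_triang|]; rewrite Rabs_Ropp, Rabs_mult; nra. }
    (* With [ka = 1 - sg] one has [sg * (1 + ka) = 1 - (1 - sg) ^ 2], which leaves the room required
       for the box. The factor [2 + |al|] comes from [A = phi - al * B]. *)
    apply (flag_not_improvable sg (1 - sg) ((2 + Rabs al) * ep) x' (al * x' + be) (/ l ^ 2)
             r1 r2 q A B C u1 u2 u3 v1 v2 v3); auto.
    + apply Rinv_0_lt_compat; nra.
    + lra.
    + nra.
    + nra.
    + rewrite Hsq; exact HAb.
    + rewrite Hsq; nra.
    + replace (IZR C - IZR A * x' - IZR B * (al * x' + be)) with (f - phi * x')
        by (unfold f, phi; ring).
      assert (hi : 0 < / l ^ 2) by (apply Rinv_0_lt_compat; nra).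
      assert (hii : / l ^ 2 * l ^ 2 = 1) by (field; exact Hl0).
      split; nra.
    + rewrite Hsq, HY.
      apply (Rmult_le_reg_r (Rabs l)); [exact Hl2|].
      rewrite Rmult_assoc, (Rmult_comm (/ Rabs l)), Hill.
      assert (h := Rabs_triang_inv l (- (al * X))); rewrite Rabs_Ropp in h.
      replace (l - - (al * X)) with (l + al * X) in h by ring.
      assert (Rabs al * ep <= 1 - sg) by nra.
      nra.
    + rewrite Hsq, HY; fold X; apply Hb.
      assert (h := Rabs_triang l (al * X)).
      assert (h0 : (1 + Rabs al) * ep <= 1 - sg) by nra.
      apply (Rmult_le_compat_r (Rabs l)) in h0; lra.
Qed.

(* The three boxes rule out, in turn, a too small orthogonal vector [d], a too small denominator
   [q], and a too small transversal coordinate [l] of the approximation [m]. *)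
Lemma nonimprovable_windows (al be sg : R) :
  0 < sg < 1 ->
  exists (k : nat) (P1 P2 P3 Q1 Q2 Q3 T1 T2 T3 M c n0 : R), (0 < k)%nat /\
    (0 < P1 /\ 0 < P2 /\ 0 < P3 /\ P1 * P2 * P3 <= / 10000) /\
    (0 < Q1 /\ 0 < Q2 /\ 0 < Q3 /\ Q1 * Q2 * Q3 <= / 10000) /\
    (0 < T1 /\ 0 < T2 /\ 0 < T3 /\ T1 * T2 * T3 <= / 10000) /\
    0 < c <= M /\
    forall n x, n0 <= INR n ->
      let S := INR (k * n) in
      ~ near_rational_line al be P1 P2 P3 S x ->
      ~ near_rational_line al be Q1 Q2 Q3 S x ->
      ~ near_rational_line al be T1 T2 T3 S x ->
      exists w, Rabs (w - x) <= M / S ^ 3 /\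
        forall x', w <= x' <= w + c / S ^ 3 ->
          exists Q, S ^ 2 <= Q /\ ~ improvable sg Q (x', al * x' + be).
Proof.
  intros Hsg.
  assert (pal := Rabs_pos al).
  set (ep := (1 - sg) ^ 2 / (2 * (2 + Rabs al))).
  assert (Hep0 : 0 < ep) by (apply Rdiv_lt_0_compat; nra).
  assert (Hep : 2 * ((2 + Rabs al) * ep) = (1 - sg) ^ 2) by (unfold ep; field; lra).
  assert (Hep1 : ep <= 1) by nra.
  assert (Hep3 : 0 < ep ^ 3) by (apply pow_lt; exact Hep0).
  (* The constant 900 brings the first product, [81 / (K * ep ^ 3) ^ 2], below [/ 10000]. *)
  destruct (exists_nat_ceil (900 / ep ^ 3)) as (k & Hk & _).
  { left; apply Rdiv_lt_0_compat; lra. }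
  assert (Hk900 : 900 < INR k * ep ^ 3).
  { apply (Rmult_lt_compat_r (ep ^ 3)) in Hk; [|exact Hep3].
    replace (900 / ep ^ 3 * ep ^ 3) with 900 in Hk by (field; lra); exact Hk. }
  set (K := INR k) in *.
  assert (HK0 : 0 < K) by (apply Rlt_trans with (900 / ep ^ 3); [apply Rdiv_lt_0_compat; lra|exact Hk]).
  assert (Hek : 1 <= ep * K).
  { assert (ep * ep <= 1) by nra.
    replace (K * ep ^ 3) with ((ep * K) * (ep * ep)) in Hk900 by ring.
    assert (0 < ep * K) by nra; nra. }
  assert (HK1 : 1 <= K) by nra.
  (* The second product is [72 * K * s0], hence equal to [/ 10000]; [z0] is the resulting lower
     bound for [q / S ^ 2]. *)
  set (s0 := / (720000 * K)).
  assert (Hs0 : 0 < s0) by (apply Rinv_0_lt_compat; lra).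
  set (z0 := s0 ^ 2 / 2).
  assert (Hz0 : 0 < z0) by (unfold z0; nra).
  (* The third product is [4 * c' * K / z0], again [/ 10000]; [l0] is the resulting lower bound for
     [|l| * S]. *)
  set (c' := z0 / (40000 * K)).
  assert (Hc' : 0 < c') by (apply Rdiv_lt_0_compat; lra).
  set (l0 := c' ^ 2 * K / 3).
  assert (Hl0 : 0 < l0) by (unfold l0; assert (0 < c' ^ 2) by nra; nra).
  (* [M] comes from [q * |w - x| <= |X| + ep * |l| <= 2 * K / S] and [q >= z0 * S ^ 2]; [c1] comes
     from the window length with [|l| >= l0 / S] and [|phi| <= 2 * ep * K * S]. *)
  set (M := 2 * K / z0).
  assert (HM : 0 < M) by (apply Rdiv_lt_0_compat; lra).
  set (c1 := (1 - sg) * l0 ^ 2 / (2 * ep * K)).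
  assert (Hc1 : 0 < c1) by (apply Rdiv_lt_0_compat; [assert (0 < l0 ^ 2) by nra|]; nra).
  assert (HepK : 0 < ep ^ 2 * K) by (assert (0 < ep ^ 2) by nra; nra).
  assert (Hep2 : 0 < ep ^ 2) by nra.
  assert (Hnu : 0 < 3 / (ep ^ 2 * K)) by (apply Rdiv_lt_0_compat; lra).
  (* The minimum secures [c <= M], the maximum [1 <= s0 * S] and [2 <= c' * S]. *)
  exists k, (3 / (ep ^ 2 * K)), (3 / (ep ^ 2 * K)), (9 / ep ^ 2),
    (2 * s0), (2 * s0), (18 * K / s0), c', (2 / c'), (2 * c' * K / z0),
    M, (Rmin c1 M), (Rmax (/ s0) (2 / c')).
  assert (Hkn : (0 < k)%nat) by (apply INR_lt; exact HK0).
  split; [exact Hkn|].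
  split; [split; [exact Hnu|split; [exact Hnu|split; [apply Rdiv_lt_0_compat; lra|]]]|].
  { replace (3 / (ep ^ 2 * K) * (3 / (ep ^ 2 * K)) * (9 / ep ^ 2))
      with (81 / (K * ep ^ 3) ^ 2) by (field; lra).
    apply (Rmult_le_reg_r ((K * ep ^ 3) ^ 2)); [nra|].
    replace (81 / (K * ep ^ 3) ^ 2 * (K * ep ^ 3) ^ 2) with 81 by (field; nra).
    nra. }
  split; [split; [lra|split; [lra|split; [apply Rdiv_lt_0_compat; lra|]]]|].
  { right; unfold s0; field; lra. }
  split; [split; [lra|split; [apply Rdiv_lt_0_compat; lra|split; [apply Rdiv_lt_0_compat; nra|]]]|].
  { replace (c' * (2 / c') * (2 * c' * K / z0)) with (4 * c' * K / z0) by (field; lra).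
    right; unfold c'; field; lra. }
  split.
  { split; [apply Rmin_pos; assumption | apply Rmin_r]. }
  intros n x Hn S H1 H2 H3.
  assert (Hn1 : / s0 <= INR n) by (eapply Rle_trans; [apply Rmax_l|exact Hn]).
  assert (Hn2 : 2 / c' <= INR n) by (eapply Rle_trans; [apply Rmax_r|exact Hn]).
  assert (His0 : 0 < / s0) by (apply Rinv_0_lt_compat; exact Hs0).
  assert (Hn0 : (0 < n)%nat) by (apply INR_lt; simpl; lra).
  assert (HSn : S = K * INR n) by (unfold S, K; apply mult_INR).
  assert (HSge : INR n <= S) by nra.
  assert (HS : 0 < S) by lra.
  assert (HsS : 1 <= s0 * S).
  { assert (h : s0 * / s0 = 1) by (field; lra); nra. }
  assert (HcS : 2 <= c' * S).
  { assert (h : c' * (2 / c') = 2) by (field; lra); nra. }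
  assert (HS1 : 1 <= S).
  { replace 1 with (INR 1) by reflexivity; apply Rle_trans with (INR n); [apply le_INR; lia|lra]. }
  destruct (primitive_approximation al be x k n Hkn Hn0)
    as (r1 & r2 & q & u1 & u2 & u3 & Hu & Hq & HqS & HX & Hl).
  fold S K in HqS, HX, Hl.
  assert (Hqlow := denominator_lower_bound al be x K S s0 r1 r2 q HK1 Hs0 HsS HS Hq HX Hl H2).
  fold z0 in Hqlow.
  assert (Hllow := transversal_lower_bound al be x K S c' z0 r1 r2 q HK1 Hc' HcS HS Hz0 Hq
                     (conj Hqlow HqS) HX H3).
  fold l0 in Hllow.
  destruct (primitive_orthogonal al be x K S ep r1 r2 q HK1 (conj Hep0 Hep1) ltac:(nra) HS Hq HqS HX Hl H1)
    as (A & B & C & v1 & v2 & v3 & Hv & Hort & HB & Hphi & HphiS).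
  set (l := IZR q * be - al * IZR r1 + IZR r2) in *.
  assert (pl := Rabs_pos l).
  assert (Hlpos : 0 < Rabs l) by nra.
  assert (Hl0' : l <> 0) by (intros E; rewrite E, Rabs_R0 in Hlpos; lra).
  destruct (flag_window al be x sg ep K S r1 r2 q A B C u1 u2 u3 v1 v2 v3) as (w & Hw & Hwin);
    auto; try lra.
  fold l in Hw, Hwin.
  assert (HS3 : 0 < S ^ 3) by (apply pow_lt; exact HS).
  assert (HS2 : 0 < S ^ 2) by (apply pow_lt; exact HS).
  assert (Hll : l ^ 2 = Rabs l * Rabs l) by (rewrite <- Rabs_mult, Rabs_right; [ring | nra]).
  assert (HlS : Rabs l * S <= 1) by nra.
  exists w; split.
  - set (X := IZR q * x + IZR r1) in *.
    assert (pw := Rabs_pos (w - x)).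
    apply (Rmult_le_reg_r (z0 * S ^ 3)); [nra|].
    replace (M / S ^ 3 * (z0 * S ^ 3)) with (2 * K) by (unfold M; field; lra).
    apply Rle_trans with (IZR q * Rabs (w - x) * S).
    + replace (Rabs (w - x) * (z0 * S ^ 3)) with (z0 * S ^ 2 * Rabs (w - x) * S) by ring.
      apply Rmult_le_compat_r; [lra|]; nra.
    + apply Rle_trans with ((Rabs X + ep * Rabs l) * S); [nra|].
      assert (ep * (Rabs l * S) <= 1) by nra; nra.
  - intros x' Hx'; exists (/ l ^ 2); split.
    + apply (Rmult_le_reg_r (l ^ 2)); [nra|].
      replace (/ l ^ 2 * l ^ 2) with 1 by (field; exact Hl0').
      rewrite Hll; nra.
    + apply Hwin; split; [lra|].
      apply Rle_trans with (w + Rmin c1 M / S ^ 3); [lra|].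
      apply Rplus_le_compat_l.
      set (phi := IZR A + al * IZR B) in *.
      assert (Hp0 : 0 < Rabs phi).
      { assert (1 <= IZR q) by (apply IZR_le; lia).
        assert (0 < ep ^ 2 * K * S) by (apply Rmult_lt_0_compat; lra).
        destruct (Rle_lt_dec (Rabs phi) 0) as [h|h]; [nra | exact h]. }
      apply Rle_trans with (c1 / S ^ 3).
      { apply Rmult_le_compat_r; [left; apply Rinv_0_lt_compat; exact HS3 | apply Rmin_l]. }
      apply (Rmult_le_reg_r (Rabs phi * S ^ 3)); [nra|].
      replace ((1 - sg) * l ^ 2 / Rabs phi * (Rabs phi * S ^ 3)) with ((1 - sg) * (l ^ 2 * S ^ 2) * S)
        by (field; lra).
      replace (c1 / S ^ 3 * (Rabs phi * S ^ 3)) with (c1 * Rabs phi) by (field; lra).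
      apply Rle_trans with (c1 * (2 * (ep * K * S))); [apply Rmult_le_compat_l; lra|].
      replace (c1 * (2 * (ep * K * S))) with ((1 - sg) * l0 ^ 2 * S) by (unfold c1; field; lra).
      apply Rmult_le_compat_r; [lra|]; apply Rmult_le_compat_l; [lra|].
      replace (l ^ 2 * S ^ 2) with ((Rabs l * S) ^ 2) by (rewrite Rpow_mult_distr, pow2_abs; ring).
      apply pow_incr; lra.
Qed.

(** * Points near rational lines *)

Lemma covered_strip (p c eta : R) : p <> 0 -> 0 <= eta ->
  covered (fun x => Rabs (c - p * x) < eta) (2 * eta / Rabs p).
Proof.
  intros Hp Heta.
  assert (Hp' : 0 < Rabs p) by (apply Rabs_pos_lt; exact Hp).
  assert (Hr : 0 <= eta / Rabs p)
    by (apply Rmult_le_pos; [|left; apply Rinv_0_lt_compat]; assumption).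
  eapply covered_mono; [| |apply (covered_interval (c / p - eta / Rabs p) (c / p + eta / Rabs p))].
  - intros x Hx.
    assert (h : Rabs (c / p - x) < eta / Rabs p).
    { apply (Rmult_lt_reg_l (Rabs p)); [exact Hp'|]; rewrite <- Rabs_mult.
      replace (p * (c / p - x)) with (c - p * x) by (field; exact Hp).
      replace (Rabs p * (eta / Rabs p)) with eta by (field; lra); exact Hx. }
    apply Rabs_def2 in h; lra.
  - right; field; lra.
  - lra.
Qed.

(** The values [p * x + b] fill an interval of length [|p| * (v - u)], and each integer near it
    contributes one strip; the [3] absorbs the end points and the margin [eta]. *)
Lemma covered_near_integers (p b eta u v : R) : p <> 0 -> 0 <= eta <= / 2 -> u <= v ->
  covered (fun x => (exists C : Z, Rabs (IZR C - p * x - b) < eta) /\ u <= x < v)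
    ((Rabs p * (v - u) + 3) * (2 * eta / Rabs p)).
Proof.
  intros Hp Heta Huv.
  assert (Hp' : 0 < Rabs p) by (apply Rabs_pos_lt; exact Hp).
  assert (Hlen : 0 <= 2 * eta / Rabs p)
    by (apply Rmult_le_pos; [|left; apply Rinv_0_lt_compat]; lra).
  assert (Hrange : exists lo, forall x, u <= x < v -> lo <= p * x + b <= lo + Rabs p * (v - u)).
  { destruct (Rlt_le_dec 0 p) as [h|h].
    - exists (p * u + b); intros x Hx; rewrite Rabs_right by lra; split; nra.
    - exists (p * v + b); intros x Hx; rewrite Rabs_left by lra; split; nra. }
  destruct Hrange as (lo & Hlo).
  set (zs := Zrange (lo - eta) (lo + Rabs p * (v - u) + eta)).
  eapply covered_mono; [| |apply (covered_list_union Z zs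
    (fun C x => Rabs (IZR C - b - p * x) < eta) (2 * eta / Rabs p))].
  - intros x [(C & HC) Hx]; exists C; split.
    + apply In_Zrange; specialize (Hlo x Hx); apply Rabs_def2 in HC; lra.
    + replace (IZR C - b - p * x) with (IZR C - p * x - b) by ring; exact HC.
  - apply Rmult_le_compat_r; [exact Hlen|].
    assert (0 <= Rabs p * (v - u)) by (apply Rmult_le_pos; lra).
    assert (h := length_Zrange (lo - eta) (lo + Rabs p * (v - u) + eta) ltac:(lra)).
    fold zs in h; lra.
  - intros C _; apply covered_strip; [exact Hp | lra].
Qed.

Lemma list_uniform_bound (T : Type) (P : T -> R -> Prop) (l : list T) :
  (forall a d d', P a d -> d' <= d -> P a d') ->
  (forall a, In a l -> exists d, 0 < d /\ P a d) ->
  exists d, 0 < d /\ forall a, In a l -> P a d.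
Proof.
  intros Hmono; induction l as [|a l IH]; intros H.
  - exists 1; split; [lra|]; intros a [].
  - destruct (H a (or_introl eq_refl)) as (d1 & Hd1 & H1).
    destruct IH as (d2 & Hd2 & H2); [intros b Hb; apply H; right; exact Hb|].
    exists (Rmin d1 d2); split; [apply Rmin_pos; assumption|].
    intros b [<-|Hb]; [apply (Hmono a d1); [exact H1|apply Rmin_l] |
      apply (Hmono b d2); [apply H2; exact Hb | apply Rmin_r]].
Qed.

(** Only finitely many pairs [(j, l)] occur, and for each the values form a coset of the integers,
    whose nonzero elements stay away from zero. *)
Lemma integer_form_gap (al be M : R) :
  exists d, 0 < d /\ forall i j l : Z, Rabs (IZR j) <= M -> Rabs (IZR l) <= M ->
    Rabs (IZR i + al * IZR j - be * IZR l) < d -> IZR i + al * IZR j - be * IZR l = 0.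
Proof.
  set (P := fun (jl : Z * Z) (d : R) => forall i : Z,
    Rabs (IZR i + al * IZR (fst jl) - be * IZR (snd jl)) < d ->
    IZR i + al * IZR (fst jl) - be * IZR (snd jl) = 0).
  destruct (list_uniform_bound _ P (list_prod (Zrange (- M) M) (Zrange (- M) M)))
    as (d & Hd & H).
  - intros a d d' Ha Hd' i Hi; apply Ha; lra.
  - intros [j l] _; unfold P; simpl.
    set (y := al * IZR j - be * IZR l).
    assert (Hy : exists d, 0 < d /\ forall i : Z, Rabs (IZR i + y) < d -> IZR i + y = 0).
    { destruct (exists_floor (- y)) as (z & Hz).
      destruct (Req_dec (IZR z) (- y)) as [E|E].
      - exists 1; split; [lra|]; intros i Hi.
        assert (h : (i - z)%Z = 0%Z).
        { apply IZR_small_zero; rewrite minus_IZR, E.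
          replace (IZR i - - y) with (IZR i + y) by ring; exact Hi. }
        replace i with z by lia; lra.
      - exists (Rmin (- y - IZR z) (IZR z + 1 + y)); split; [apply Rmin_pos; lra|].
        intros i Hi; exfalso; apply Rabs_def2 in Hi as [h1 h2].
        assert (m1 := Rmin_l (- y - IZR z) (IZR z + 1 + y)).
        assert (m2 := Rmin_r (- y - IZR z) (IZR z + 1 + y)).
        assert (b1 : (z < i)%Z) by (apply lt_IZR; lra).
        assert (b2 : (i < z + 1)%Z) by (apply lt_IZR; rewrite plus_IZR; lra).
        lia. }
    destruct Hy as (d & Hd & Hy); exists d; split; [exact Hd|].
    intros i; replace (IZR i + al * IZR j - be * IZR l) with (IZR i + y) by (unfold y; ring).
    apply Hy.
  - exists d; split; [exact Hd|]; intros i j l Hj Hl.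
    assert (Hrng : forall z : Z, Rabs (IZR z) <= M -> In z (Zrange (- M) M)).
    { intros z Hz; apply In_Zrange; assert (h1 := Rle_abs (IZR z)); assert (h2 := Rle_abs (- IZR z)).
      rewrite Rabs_Ropp in h2; lra. }
    apply (H (j, l)); apply in_prod; apply Hrng; assumption.
Qed.

Lemma Rabs_cross_le a b c d m n :
  Rabs a <= m -> Rabs d <= m -> Rabs b <= n -> Rabs c <= n -> Rabs (a * b - d * c) <= 2 * m * n.
Proof.
  intros Ha Hd Hb Hc; unfold Rminus; eapply Rle_trans; [apply Rabs_triang|].
  rewrite Rabs_Ropp.
  assert (h1 := Rabs_mult_le a b m n Ha Hb); assert (h2 := Rabs_mult_le d c m n Hd Hc); lra.
Qed.

(* The cross product of the two lines is an integer vector in a bounded set, on which a linear form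
   with values going to zero must eventually vanish. *)
Lemma common_zero_of_flat_lines (al be K P F : R) :
  0 < K -> 0 < P -> 0 < F ->
  exists S0, 1 <= S0 /\ forall (S : R) (A B C A' B' C' : Z), S0 <= S ->
    Rabs (IZR A + al * IZR B) <= K / S -> Rabs (IZR A' + al * IZR B') <= K / S ->
    Rabs (IZR B) <= P * S -> Rabs (IZR B') <= P * S ->
    Rabs (IZR C - IZR B * be) <= F / S -> Rabs (IZR C' - IZR B' * be) <= F / S ->
    (IZR A + al * IZR B) * (IZR C' - IZR B' * be) =
    (IZR A' + al * IZR B') * (IZR C - IZR B * be).
Proof.
  intros HK HP HF.
  destruct (integer_form_gap al be (2 * P * F + 2 * P * K)) as (d & Hd & Hgap).
  exists (Rmax 1 (2 * K * F / d + 1)); split; [apply Rmax_l|].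
  intros S A B C A' B' C' HS HA HA' HB HB' HC HC'.
  assert (HS1 : 1 <= S) by (eapply Rle_trans; [apply Rmax_l|exact HS]).
  assert (HSd : 2 * K * F < d * S).
  { assert (h : 2 * K * F / d + 1 <= S) by (eapply Rle_trans; [apply Rmax_r|exact HS]).
    replace (2 * K * F) with (d * (2 * K * F / d)) by (field; lra).
    apply Rmult_lt_compat_l; lra. }
  assert (HPK : 0 < P * K) by nra.
  assert (HPF : 0 < P * F) by nra.
  set (phi := IZR A + al * IZR B) in *; set (phi' := IZR A' + al * IZR B') in *.
  set (f := IZR C - IZR B * be) in *; set (f' := IZR C' - IZR B' * be) in *.
  (* The integer form is evaluated at the minors of the two integer vectors; these are bounded
     independently of [S], while the value is of order [S ^ -2]. *)
  assert (HD : IZR (A * C' - A' * C) + al * IZR (B * C' - B' * C) - be * IZR (A * B' - A' * B)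
    = phi * f' - phi' * f).
  { unfold phi, phi', f, f'; rewrite !minus_IZR, !mult_IZR; ring. }
  apply Rminus_diag_uniq; rewrite <- HD; apply Hgap.
  - replace (IZR (B * C' - B' * C)) with (IZR B * f' - IZR B' * f)
      by (unfold f, f'; rewrite minus_IZR, !mult_IZR; ring).
    eapply Rle_trans; [apply (Rabs_cross_le _ _ _ _ (P * S) (F / S)); assumption|].
    replace (2 * (P * S) * (F / S)) with (2 * P * F) by (field; lra); lra.
  - replace (IZR (A * B' - A' * B)) with (IZR B' * phi - IZR B * phi')
      by (unfold phi, phi'; rewrite minus_IZR, !mult_IZR; ring).
    eapply Rle_trans; [apply (Rabs_cross_le _ _ _ _ (P * S) (K / S)); assumption|].
    replace (2 * (P * S) * (K / S)) with (2 * P * K) by (field; lra); lra.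
  - rewrite HD.
    eapply Rle_lt_trans; [apply (Rabs_cross_le _ _ _ _ (K / S) (F / S)); assumption|].
    apply (Rmult_lt_reg_r (S * S)); [nra|].
    replace (2 * (K / S) * (F / S) * (S * S)) with (2 * K * F) by (field; lra).
    assert (0 < d * S) by nra; nra.
Qed.

(* No rational line of height of order [S] is, over a bounded part of the line
   [y = al * x + be], uniformly within order [S ^ -3] of it. *)
Definition no_close_rational_line (al be r S : R) : Prop :=
  forall A B C : Z, Rabs (IZR A + al * IZR B) <= r / S ^ 2 -> Rabs (IZR B) <= r * S ->
    Rabs (IZR C - IZR B * be) <= r / S ^ 2 -> (A = 0 /\ B = 0)%Z.

Lemma no_close_rational_line_mono (al be r r' S : R) : 0 < S -> r' <= r ->
  no_close_rational_line al be r S -> no_close_rational_line al be r' S.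
Proof.
  intros HS Hr H A B C H1 H2 H3.
  assert (h : r' / S ^ 2 <= r / S ^ 2).
  { apply Rmult_le_compat_r; [left; apply Rinv_0_lt_compat; apply pow_lt; exact HS | exact Hr]. }
  apply (H A B C); [lra | nra | lra].
Qed.

(** A union bound: at most [4 * b2] values of [B], for each at most [4 * b1] values of [A], and
    every pair costs [L]. *)
Lemma covered_line_family (al be L b1 b2 eta v u w : R) (cond : R -> Prop) :
  1 <= b1 -> 1 <= b2 -> u <= w ->
  0 <= L -> 
  (forall p, cond p -> Rabs p <= b1) ->
  (forall p, cond p -> forall b,
     covered (fun x => (exists C : Z, Rabs (IZR C - p * x - b) < eta) /\ u <= x < w) L) ->
  16 * b1 * b2 * L <= v ->
  covered (fun x => (exists A B C : Z, cond (IZR A + al * IZR B) /\ Rabs (IZR B) <= b2 /\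
      Rabs (IZR C - (IZR A + al * IZR B) * x - IZR B * be) < eta) /\ u <= x < w) v.
Proof.
  intros Hb1 Hb2 Huw HL Hcond Hcov Hv.
  set (As := fun B : Z => Zrange (- b1 - al * IZR B) (b1 - al * IZR B)).
  set (E := fun (B A : Z) (x : R) => cond (IZR A + al * IZR B) /\
    (exists C : Z, Rabs (IZR C - (IZR A + al * IZR B) * x - IZR B * be) < eta) /\ u <= x < w).
  assert (H1 : forall B, covered (fun x => exists A, In A (As B) /\ E B A x) (4 * b1 * L)).
  { intros B; eapply covered_mono; [| |apply (covered_list_union Z (As B) (E B) L)]; [tauto| |].
    - apply Rmult_le_compat_r; [exact HL|].
      assert (h := length_Zrange (- b1 - al * IZR B) (b1 - al * IZR B) ltac:(lra)).
      unfold As; lra.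
    - intros A _; destruct (classic (cond (IZR A + al * IZR B))) as [h|h].
      + eapply covered_mono; [| |apply (Hcov _ h (IZR B * be))]; [unfold E; tauto | lra].
      + apply covered_none; [exact HL|]; unfold E; tauto. }
  assert (Hrng : forall p b, Rabs p <= b -> - b <= p <= b).
  { intros p b h; assert (h1 := Rle_abs p); assert (h2 := Rle_abs (- p)).
    rewrite Rabs_Ropp in h2; lra. }
  eapply covered_mono; [| |apply (covered_list_union Z (Zrange (- b2) b2)
    (fun B x => exists A, In A (As B) /\ E B A x) (4 * b1 * L))].
  - intros x [(A & B & C & Hc & HB & HC) Hx]; exists B; split.
    + apply In_Zrange, Hrng, HB.
    + exists A; split; [|unfold E; eauto].
      apply In_Zrange; assert (h := Hrng _ _ (Hcond _ Hc)); clear - h; lra.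
  - assert (h := length_Zrange (- b2) b2 ltac:(lra)).
    apply Rle_trans with (4 * b2 * (4 * b1 * L)); [|lra].
    apply Rmult_le_compat_r; [apply Rmult_le_pos; lra | lra].
  - intros B _; apply H1.
Qed.

(** The lines are sorted by [phi]. For [|phi| >= / L] counting the integers [C] gives the main term.
    For [K / S <= |phi| <= / L] boundedly many [A] occur per [B], and [K] is large enough for the
    strips to add up to [L / 48]. The flatter lines all meet the given line at one abscissa, and a
    single interval of length [L / 48] suffices. *)
Lemma covered_near_rational_line (al be P1 P2 P3 u v : R) :
  0 < P1 -> 0 < P2 -> 0 < P3 -> u < v ->
  exists r S0, 0 < r /\ forall S, S0 <= S -> no_close_rational_line al be r S ->
    covered (fun x => near_rational_line al be P1 P2 P3 S x /\ u <= x < v)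
      (128 * (P1 * P2 * P3) * (v - u) + (v - u) / 24).
Proof.
  intros HP1 HP2 HP3 Huv.
  set (L := v - u); assert (HL : 0 < L) by (unfold L; lra).
  set (b := 1 + / L); assert (HiL : 0 < / L) by (apply Rinv_0_lt_compat; exact HL).
  set (K := 48 * 16 * b * P2 * (8 * P3) / L + 1).
  assert (HK0 : 0 <= 48 * 16 * b * P2 * (8 * P3) / L).
  { apply Rmult_le_pos; [|lra]; repeat apply Rmult_le_pos; unfold b; lra. }
  assert (HK : 0 < K) by (unfold K; lra).
  set (X := Rabs u + Rabs v); assert (HX : 0 <= X).
  { unfold X; assert (h1 := Rabs_pos u); assert (h2 := Rabs_pos v); lra. }
  (* Chosen so that [eta / (r1 / S ^ 2) = L / 96], half the length allotted to the flat lines. *)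
  set (r1 := 96 * P3 / L); assert (Hr1 : 0 < r1) by (apply Rdiv_lt_0_compat; lra).
  destruct (common_zero_of_flat_lines al be K P2 (P3 + K * X)) as (S1 & HS1 & Hzero);
    [exact HK | exact HP2 | nra |].
  set (r := r1 + P2 + P3 + r1 * X).
  assert (HrX : 0 <= r1 * X) by (apply Rmult_le_pos; lra).
  exists r, (S1 + / P1 + / P2 + 2 * P3); split; [unfold r; lra|].
  intros S HS Hno.
  assert (Hi1 : 0 < / P1) by (apply Rinv_0_lt_compat; exact HP1).
  assert (Hi2 : 0 < / P2) by (apply Rinv_0_lt_compat; exact HP2).
  assert (HSS1 : S1 <= S) by lra.
  assert (HS1' : 1 <= S) by lra.
  assert (HP1S : 1 <= P1 * S).
  { replace 1 with (P1 * / P1) by (field; lra); apply Rmult_le_compat_l; lra. }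
  assert (HP2S : 1 <= P2 * S).
  { replace 1 with (P2 * / P2) by (field; lra); apply Rmult_le_compat_l; lra. }
  assert (HS2 : 0 < S ^ 2) by nra.
  set (eta := P3 / S ^ 2).
  assert (Heta0 : 0 < eta) by (apply Rdiv_lt_0_compat; lra).
  assert (HetaS : eta * S ^ 2 = P3) by (unfold eta; field; lra).
  assert (Heta : 0 <= eta <= / 2).
  { split; [lra|]; apply (Rmult_le_reg_r (S ^ 2)); [exact HS2|]; rewrite HetaS; nra. }
  set (fam := fun cond : R -> Prop => fun x =>
    (exists A B C : Z, cond (IZR A + al * IZR B) /\ Rabs (IZR B) <= P2 * S /\
      Rabs (IZR C - (IZR A + al * IZR B) * x - IZR B * be) < eta) /\ u <= x < v).
  assert (Hbig : covered (fam (fun p => / L <= Rabs p /\ Rabs p <= P1 * S))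
    (128 * (P1 * P2 * P3) * L)).
  { apply (covered_line_family al be (8 * eta * L) (P1 * S) (P2 * S)); try lra; try tauto.
    - nra.
    - intros p [Hp1 Hp2] c.
      assert (Hp : p <> 0) by (intros E; rewrite E, Rabs_R0 in Hp1; lra).
      eapply covered_mono; [| |apply (covered_near_integers p c eta u v Hp Heta)]; [tauto| |lra].
      fold L; apply (Rmult_le_reg_r (Rabs p)); [lra|].
      replace ((Rabs p * L + 3) * (2 * eta / Rabs p) * Rabs p)
        with ((Rabs p * L + 3) * (2 * eta)) by (field; lra).
      assert (1 <= Rabs p * L).
      { replace 1 with (/ L * L) by (field; lra); apply Rmult_le_compat_r; lra. }
      nra.
    - right; rewrite <- HetaS; ring. }
  assert (Hmid : covered (fam (fun p => K / S <= Rabs p /\ Rabs p <= / L)) (L / 48)).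
  { assert (HKS : 0 < K / S) by (apply Rdiv_lt_0_compat; lra).
    assert (Hpos : 0 < 8 * (eta * S / K)).
    { apply Rmult_lt_0_compat; [lra|]; apply Rdiv_lt_0_compat; nra. }
    apply (covered_line_family al be (8 * (eta * S / K)) b (P2 * S)); try lra.
    - unfold b; lra.
    - intros p [_ h]; unfold b; lra.
    - intros p [Hp1 Hp2] c.
      assert (Hp : p <> 0) by (intros E; rewrite E, Rabs_R0 in Hp1; lra).
      eapply covered_mono; [| |apply (covered_near_integers p c eta u v Hp Heta)]; [tauto| |lra].
      fold L; apply (Rmult_le_reg_r (Rabs p)); [lra|].
      replace ((Rabs p * L + 3) * (2 * eta / Rabs p) * Rabs p)
        with ((Rabs p * L + 3) * (2 * eta)) by (field; lra).
      assert (Rabs p * L <= 1).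
      { replace 1 with (/ L * L) by (field; lra); apply Rmult_le_compat_r; lra. }
      apply Rle_trans with (8 * (eta * S / K) * (K / S)).
      + replace (8 * (eta * S / K) * (K / S)) with (8 * eta) by (field; lra); nra.
      + apply Rmult_le_compat_l; lra.
    - apply (Rmult_le_reg_r (48 * K / L)); [apply Rdiv_lt_0_compat; lra|].
      replace (L / 48 * (48 * K / L)) with K by (field; lra).
      replace (16 * b * (P2 * S) * (8 * (eta * S / K)) * (48 * K / L))
        with (48 * 16 * b * P2 * (8 * (eta * S ^ 2)) / L) by (field; lra).
      rewrite HetaS; unfold K; lra. }
  set (flat := fun (A B C : Z) x => (A <> 0 \/ B <> 0)%Z /\
    Rabs (IZR A + al * IZR B) <= K / S /\ Rabs (IZR B) <= P2 * S /\
    Rabs (IZR C - (IZR A + al * IZR B) * x - IZR B * be) < eta /\ u <= x < v).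
  assert (Hfacts : forall A B C x, flat A B C x ->
    Rabs (IZR C - IZR B * be) <= (P3 + K * X) / S /\ r1 / S ^ 2 < Rabs (IZR A + al * IZR B)).
  { intros A B C x (HAB & HA & HB & HC & Hx).
    set (phi := IZR A + al * IZR B) in *.
    assert (Hxa : Rabs x <= X).
    { unfold X, Rabs; repeat destruct Rcase_abs; lra. }
    assert (Hf : Rabs (IZR C - IZR B * be) <= eta + Rabs phi * X).
    { replace (IZR C - IZR B * be) with ((IZR C - phi * x - IZR B * be) + phi * x) by ring.
      eapply Rle_trans; [apply Rabs_triang|]; rewrite Rabs_mult.
      assert (p0 := Rabs_pos phi); nra. }
    split.
    - eapply Rle_trans; [exact Hf|].
      apply (Rmult_le_reg_r S); [lra|].
      replace ((P3 + K * X) / S * S) with (P3 + K * X) by (field; lra).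
      assert (h1 : eta * S <= P3) by nra.
      assert (h2 : Rabs phi * S <= K).
      { apply (Rmult_le_compat_r S) in HA; [|lra].
        replace (K / S * S) with K in HA by (field; lra); exact HA. }
      nra.
    (* A still flatter line would violate [no_close_rational_line]: [r] dominates the constants in
       all three bounds. *)
    - destruct (Rlt_le_dec (r1 / S ^ 2) (Rabs phi)) as [h|h]; [exact h|exfalso].
      enough ((A = 0 /\ B = 0)%Z) by tauto.
      assert (Hi : 0 <= / S ^ 2) by (left; apply Rinv_0_lt_compat; exact HS2).
      apply (Hno A B C).
      + eapply Rle_trans; [exact h|]; apply Rmult_le_compat_r; [exact Hi | unfold r; lra].
      + assert (P2 * S <= r * S) by (apply Rmult_le_compat_r; unfold r; lra); lra.
      + eapply Rle_trans; [exact Hf|].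
        apply Rle_trans with (eta + r1 / S ^ 2 * X); [nra|].
        replace (eta + r1 / S ^ 2 * X) with ((P3 + r1 * X) / S ^ 2) by (unfold eta; field; lra).
        apply Rmult_le_compat_r; [exact Hi | unfold r; lra]. }
  assert (Hflat : covered (fun x => exists A B C, flat A B C x) (L / 48)).
  { destruct (classic (exists x A B C, flat A B C x)) as [(x0 & A0 & B0 & C0 & H0)|Hnex].
    2:{ apply covered_none; [lra|]; intros x Hx; apply Hnex; exists x; exact Hx. }
    destruct (Hfacts _ _ _ _ H0) as [Hf0 Hp0].
    destruct H0 as (_ & HA0 & HB0 & _ & _).
    assert (Hr1S : 0 < r1 / S ^ 2) by (apply Rdiv_lt_0_compat; lra).
    set (phi0 := IZR A0 + al * IZR B0) in *.
    assert (Hp0n : phi0 <> 0) by (intros E; rewrite E, Rabs_R0 in Hp0; lra).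
    set (z := (IZR C0 - IZR B0 * be) / phi0).
    eapply covered_mono; [| |apply (covered_interval (z - L / 96) (z + L / 96))]; [|lra|lra].
    intros x (A & B & C & H).
    destruct (Hfacts _ _ _ _ H) as [Hf Hp].
    destruct H as (_ & HA & HB & HC & _).
    assert (Hz := Hzero S A0 B0 C0 A B C HSS1 HA0 HA HB0 HB Hf0 Hf); fold phi0 in Hz.
    set (phi := IZR A + al * IZR B) in *.
    assert (Hfz : IZR C - phi * x - IZR B * be = phi * (z - x)).
    { replace (phi * (z - x)) with (phi * (IZR C0 - IZR B0 * be) / phi0 - phi * x)
        by (unfold z; field; exact Hp0n).
      rewrite <- Hz; field; exact Hp0n. }
    rewrite Hfz, Rabs_mult in HC.
    enough (h : Rabs (z - x) < L / 96) by (apply Rabs_def2 in h; lra).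
    assert (pz := Rabs_pos (z - x)).
    apply (Rmult_lt_reg_l (r1 / S ^ 2)); [exact Hr1S|].
    replace (r1 / S ^ 2 * (L / 96)) with eta by (unfold r1, eta; field; lra).
    nra. }
  eapply covered_mono; [| |exact (covered_union _ _ _ _ Hbig (covered_union _ _ _ _ Hmid Hflat))].
  - intros x [(A & B & C & HAB & HA & HB & HC) Hx].
    destruct (Rle_lt_dec (/ L) (Rabs (IZR A + al * IZR B))) as [h|h].
    { left; split; [exists A, B, C; tauto | exact Hx]. }
    destruct (Rle_lt_dec (K / S) (Rabs (IZR A + al * IZR B))) as [h'|h'].
    { right; left; split; [exists A, B, C|exact Hx].
      split; [split; lra | tauto]. }
    right; right; exists A, B, C; unfold flat; split; [exact HAB|split; [lra|tauto]].
  - lra.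
Qed.

(** * Scales without close rational lines *)

(** Substituting [y = al * x + be] into [A x + B y = C] makes the coefficient of [x] and the
    constant term vanish. *)
Definition rational_line (al be : R) : Prop :=
  exists A B C : Z, B <> 0%Z /\ IZR A + al * IZR B = 0 /\ IZR C - IZR B * be = 0.

(* Lines that are this close at two consecutive scales coincide, so one rational line would be
   arbitrarily close to [y = al * x + be]. *)
Lemma exists_no_close_rational_line (al be r : R) (k N : nat) :
  0 < r -> (0 < k)%nat -> ~ rational_line al be ->
  exists n, (N <= n)%nat /\ no_close_rational_line al be r (INR (k * n)).
Proof.
  intros Hr Hk Hirr; apply NNPP; intros Hno.
  set (close := fun n (A B C : Z) => (A <> 0 \/ B <> 0)%Z /\
    Rabs (IZR A + al * IZR B) <= r / INR (k * n) ^ 2 /\ Rabs (IZR B) <= r * INR (k * n) /\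
    Rabs (IZR C - IZR B * be) <= r / INR (k * n) ^ 2).
  assert (Hex : forall n, (N <= n)%nat -> exists A B C, close n A B C).
  { intros n Hn; apply NNPP; intros h; apply Hno; exists n; split; [exact Hn|].
    intros A B C H1 H2 H3; apply NNPP; intros H4; apply h; exists A, B, C.
    unfold close; split; [lia | tauto]. }
  destruct (exists_nat_ceil (4 * r ^ 2 + r + 1)) as (N1 & HN1 & _); [nra|].
  set (m := (N + N1)%nat).
  assert (HS : forall n, (m <= n)%nat -> 4 * r ^ 2 + r + 1 < INR (k * n)).
  { intros n Hn; apply Rlt_le_trans with (INR N1); [exact HN1|]; apply le_INR; nia. }
  assert (HB0 : forall n A B C, (m <= n)%nat -> close n A B C -> B <> 0%Z).
  { intros n A B C Hn (HAB & HA & _ & _) E; subst B.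
    destruct HAB as [h|h]; [|lia]; apply h, IZR_small_zero.
    specialize (HS n Hn); set (S := INR (k * n)) in *.
    replace (IZR A + al * 0) with (IZR A) in HA by ring.
    eapply Rle_lt_trans; [exact HA|]; apply (Rmult_lt_reg_r (S ^ 2)); [nra|].
    replace (r / S ^ 2 * S ^ 2) with r by (field; nra); nra. }
  (* The minors are integers. The scales differ by a factor of at most 2, so the minors are at most
     [2 * (r / s ^ 2) * (2 * r * s) < 1] and vanish. *)
  assert (Hstep : forall n n' A B C A' B' C', (m <= n)%nat -> (n <= n' <= S n)%nat ->
    close n A B C -> close n' A' B' C' ->
    (IZR A' + al * IZR B') * IZR B = (IZR A + al * IZR B) * IZR B' /\
    (IZR C' - IZR B' * be) * IZR B = (IZR C - IZR B * be) * IZR B').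
  { intros n n' A B C A' B' C' Hn Hn' (_ & HA & HB & HC) (_ & HA' & HB' & HC').
    assert (HSS : INR (k * n') <= 2 * INR (k * n)).
    { replace 2 with (INR 2) by reflexivity; rewrite <- mult_INR; apply le_INR; unfold m in Hn.
      assert (1 <= n)%nat; [|nia].
      destruct N1; [simpl in HN1; nra | lia]. }
    assert (HSl : INR (k * n) <= INR (k * n')) by (apply le_INR; nia).
    specialize (HS n Hn).
    set (s := INR (k * n)) in *; set (s' := INR (k * n')) in *.
    assert (Hle : r / s' ^ 2 <= r / s ^ 2).
    { apply Rmult_le_compat_l; [lra|]; apply Rinv_le_contravar; nra. }
    assert (Hs2 : 2 * (r / s ^ 2) * (2 * r * s) < 1).
    { replace (2 * (r / s ^ 2) * (2 * r * s)) with (4 * r ^ 2 / s) by (field; nra).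
      apply (Rmult_lt_reg_r s); [nra|]; replace (4 * r ^ 2 / s * s) with (4 * r ^ 2) by (field; nra).
      nra. }
    set (phi := IZR A + al * IZR B) in *; set (phi' := IZR A' + al * IZR B') in *.
    set (f := IZR C - IZR B * be) in *; set (f' := IZR C' - IZR B' * be) in *.
    split.
    - assert (h : (A' * B - A * B')%Z = 0%Z).
      { apply IZR_small_zero.
        replace (IZR (A' * B - A * B')) with (phi' * IZR B - phi * IZR B')
          by (unfold phi, phi'; rewrite minus_IZR, !mult_IZR; ring).
        eapply Rle_lt_trans; [apply (Rabs_cross_le _ _ _ _ (r / s ^ 2) (2 * r * s))|exact Hs2]; nra. }
      apply (f_equal IZR) in h; rewrite minus_IZR, !mult_IZR in h; unfold phi, phi'; lra.
    - assert (h : (C' * B - C * B')%Z = 0%Z).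
      { apply IZR_small_zero.
        replace (IZR (C' * B - C * B')) with (f' * IZR B - f * IZR B')
          by (unfold f, f'; rewrite minus_IZR, !mult_IZR; ring).
        eapply Rle_lt_trans; [apply (Rabs_cross_le _ _ _ _ (r / s ^ 2) (2 * r * s))|exact Hs2]; nra. }
      apply (f_equal IZR) in h; rewrite minus_IZR, !mult_IZR in h; unfold f, f'; lra. }
  destruct (Hex m) as (A0 & B0 & C0 & H0); [unfold m; lia|].
  assert (Hall : forall n A B C, (m <= n)%nat -> close n A B C ->
    (IZR A + al * IZR B) * IZR B0 = (IZR A0 + al * IZR B0) * IZR B /\
    (IZR C - IZR B * be) * IZR B0 = (IZR C0 - IZR B0 * be) * IZR B).
  { intros n A B C Hn; revert A B C; induction Hn as [|n Hn IH]; intros A' B' C' H'.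
    - apply (Hstep m m A0 B0 C0 A' B' C'); auto; lia.
    - destruct (Hex n) as (A & B & C & H); [unfold m in Hn; lia|].
      destruct (IH A B C H) as [e1 e2]; destruct (Hstep n (S n) A B C A' B' C' Hn ltac:(lia) H H') as [e3 e4].
      assert (HB : IZR B <> 0) by (apply not_0_IZR, (HB0 n A B C Hn H)).
      split; apply (Rmult_eq_reg_l (IZR B)); auto.
      + transitivity ((IZR A' + al * IZR B') * IZR B * IZR B0); [ring|].
        rewrite e3; transitivity ((IZR A + al * IZR B) * IZR B0 * IZR B'); [ring|].
        rewrite e1; ring.
      + transitivity ((IZR C' - IZR B' * be) * IZR B * IZR B0); [ring|].
        rewrite e4; transitivity ((IZR C - IZR B * be) * IZR B0 * IZR B'); [ring|].
        rewrite e2; ring. }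
  (* As [|b| >= 1], the fixed quantity [|y|] is at most [|B0|] times [|p|], and [p] can be taken
     arbitrarily small at later scales. *)
  assert (Hsmall : forall y, (forall n, (m <= n)%nat ->
      exists (b : Z) p, b <> 0%Z /\ p * IZR B0 = y * IZR b /\ Rabs p <= r / INR (k * n) ^ 2) -> y = 0).
  { intros y Hy; apply NNPP; intros Hy0.
    assert (Hyp : 0 < Rabs y) by (apply Rabs_pos_lt; exact Hy0).
    assert (pB := Rabs_pos (IZR B0)).
    assert (Hq : 0 <= r * Rabs (IZR B0) / Rabs y).
    { apply Rmult_le_pos; [nra | left; apply Rinv_0_lt_compat; exact Hyp]. }
    destruct (exists_nat_ceil _ Hq) as (N2 & HN2 & _).
    set (n := (m + N2)%nat).
    destruct (Hy n) as (b & p & Hb & Hpb & Hp); [unfold n; lia|].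
    assert (HSn := HS n ltac:(unfold n; lia)).
    assert (HSN : INR N2 <= INR (k * n)) by (apply le_INR; unfold n; nia).
    set (s := INR (k * n)) in *.
    assert (Hb1 := IZR_Rabs_ge_1 b Hb).
    assert (h1 : Rabs y <= Rabs p * Rabs (IZR B0)).
    { rewrite <- Rabs_mult, Hpb, Rabs_mult; nra. }
    assert (h2 : r * Rabs (IZR B0) < Rabs y * s).
    { replace (r * Rabs (IZR B0)) with (Rabs y * (r * Rabs (IZR B0) / Rabs y)) by (field; lra).
      apply Rmult_lt_compat_l; lra. }
    assert (h3 : Rabs p * s ^ 2 <= r).
    { apply (Rmult_le_compat_r (s ^ 2)) in Hp; [|nra].
      replace (r / s ^ 2 * s ^ 2) with r in Hp by (field; nra); exact Hp. }
    assert (h4 : Rabs y * s ^ 2 <= r * Rabs (IZR B0)) by nra.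
    assert (h5 : r * Rabs (IZR B0) < Rabs y * s ^ 2); [|lra].
    assert (0 < Rabs y * s) by (apply Rmult_lt_0_compat; lra); nra. }
  apply Hirr; exists A0, B0, C0; split; [apply (HB0 m A0 B0 C0); auto|split; apply Hsmall].
  - intros n Hn; destruct (Hex n) as (A & B & C & H); [unfold m in Hn; lia|].
    exists B, (IZR A + al * IZR B); destruct (Hall n A B C Hn H) as [e1 e2].
    split; [apply (HB0 n A B C Hn H)|split; [exact e1|apply H]].
  - intros n Hn; destruct (Hex n) as (A & B & C & H); [unfold m in Hn; lia|].
    exists B, (IZR C - IZR B * be); destruct (Hall n A B C Hn H) as [e1 e2].
    split; [apply (HB0 n A B C Hn H)|split; [exact e2|apply H]].
Qed.

(** An approximation of [x] alone with denominator [q <= N] and error [1 / N], multiplied by [B],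
    approximates both coordinates with error at most [H / N] and denominator at most [H * N]. For
    large [N] this beats [c / sqrt (B * q)]. *)
Lemma badly_approximable_not_on_rational_line (x y : R) (A B C : Z) :
  (0 < B)%Z -> IZR A * x + IZR B * y = IZR C -> ~ badly_approximable (x, y).
Proof.
  intros HB Hline (c & Hc & Hbad).
  assert (HB1 : 1 <= IZR B) by (apply IZR_le; lia).
  set (H := Rabs (IZR A) + IZR B).
  assert (pA := Rabs_pos (IZR A)).
  assert (Hq0 : 0 <= H ^ 3 / c ^ 2).
  { apply Rmult_le_pos; [apply pow_le; unfold H; lra | left; apply Rinv_0_lt_compat; nra]. }
  destruct (exists_nat_ceil _ Hq0) as (N & HN & _).
  assert (HN0 : (0 < N)%nat) by (apply INR_lt; simpl; lra).
  assert (HNR : 0 < INR N) by lra.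
  destruct (simultaneous_dirichlet x 0 0 N 1 HN0 Nat.lt_0_1) as (q & r1 & _ & Hq & HX & _).
  set (X := IZR q * x + IZR r1) in *.
  assert (pX := Rabs_pos X).
  assert (HqN : 1 <= IZR q <= INR N).
  { split; [apply IZR_le; lia|]; rewrite INR_IZR_INZ; apply IZR_le; lia. }
  set (q' := Z.to_nat (B * q)).
  assert (HqR : INR q' = IZR B * IZR q).
  { unfold q'; rewrite INR_IZR_INZ, Z2Nat.id, mult_IZR by nia; reflexivity. }
  specialize (Hbad q' (- (B * r1))%Z (q * C + A * r1)%Z ltac:(unfold q'; nia)).
  assert (Hsup : supnorm2 (approx_err (x, y) q' (- (B * r1)) (q * C + A * r1)) <= H * Rabs X).
  { unfold supnorm2, approx_err; simpl fst; simpl snd; rewrite HqR.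
    apply Rmax_lub.
    - replace (IZR B * IZR q * x - IZR (- (B * r1))) with (IZR B * X)
        by (unfold X; rewrite opp_IZR, mult_IZR; ring).
      rewrite Rabs_mult, (Rabs_right (IZR B)) by lra; unfold H; nra.
    - replace (IZR B * IZR q * y - IZR (q * C + A * r1)) with (- IZR A * X)
        by (unfold X; rewrite plus_IZR, !mult_IZR, <- Hline; ring).
      rewrite Rabs_mult, Rabs_Ropp; unfold H; nra. }
  assert (Hq'0 : 0 < INR q') by (rewrite HqR; nra).
  set (s := sqrt (INR q')) in *.
  assert (Hs : 0 < s) by (apply sqrt_lt_R0; exact Hq'0).
  assert (Hss : s * s = IZR B * IZR q) by (rewrite <- HqR; apply sqrt_sqrt; lra).
  assert (H0 : 0 < H) by (unfold H; lra).
  assert (h1 : c <= H * Rabs X * s).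
  { apply (Rmult_le_reg_r (/ s)); [apply Rinv_0_lt_compat; exact Hs|].
    rewrite Rmult_assoc, Rinv_r by lra; lra. }
  assert (h2 : c * INR N <= H * s).
  { apply Rle_trans with (H * Rabs X * s * INR N); [apply Rmult_le_compat_r; lra|].
    replace (H * Rabs X * s * INR N) with (H * s * (Rabs X * INR N)) by ring.
    assert (0 < H * s) by nra; nra. }
  assert (h3 : s * s <= H * INR N).
  { rewrite Hss; apply Rmult_le_compat; unfold H; lra. }
  assert (h4 : (c * INR N) ^ 2 <= H ^ 3 * INR N).
  { apply Rle_trans with ((H * s) ^ 2); [apply pow_incr; nra|].
    replace ((H * s) ^ 2) with (H ^ 2 * (s * s)) by ring.
    replace (H ^ 3 * INR N) with (H ^ 2 * (H * INR N)) by ring.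
    apply Rmult_le_compat_l; [nra | exact h3]. }
  assert (h5 : H ^ 3 < c ^ 2 * INR N).
  { replace (H ^ 3) with (c ^ 2 * (H ^ 3 / c ^ 2)) by (field; lra).
    apply Rmult_lt_compat_l; nra. }
  nra.
Qed.

(** * The null set *)

(** Cells have length between [6 * M / S ^ 3] and [12 * M / S ^ 3]. If the middle third of a cell
    contains a point away from the three families of rational lines, the cell contains a whole
    window and is covered up to the proportion [c1]. The families take up [L / 6], so
    [covered_packing] leaves [1 - c1 + 3 * c1 / 6 = 1 - c1 / 2]. *)
Lemma improvable_set_contraction (al be sg Q0 : R) :
  0 < sg < 1 -> ~ rational_line al be ->
  exists c, 0 <= c < 1 /\ forall u v, u < v ->
    covered (fun x => (forall Q, Q0 <= Q -> 0 < Q -> improvable sg Q (x, al * x + be)) /\ u <= x < v)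
      (c * (v - u)).
Proof.
  intros Hsg Hirr.
  set (E := fun x => forall Q, Q0 <= Q -> 0 < Q -> improvable sg Q (x, al * x + be)).
  destruct (nonimprovable_windows al be sg Hsg)
    as (k & P1 & P2 & P3 & Q1 & Q2 & Q3 & T1 & T2 & T3 & M & c & n0 & Hk &
        (HP1 & HP2 & HP3 & HP) & (HQ1 & HQ2 & HQ3 & HQ) & (HT1 & HT2 & HT3 & HT) & Hc & Hwin).
  assert (HM : 0 < M) by lra.
  set (c1 := c / (12 * M)).
  assert (Hc1 : 0 < c1 <= / 12).
  { split; [apply Rdiv_lt_0_compat; lra|].
    apply (Rmult_le_reg_r (12 * M)); [lra|].
    unfold c1; replace (c / (12 * M) * (12 * M)) with c by (field; lra); lra. }
  exists (1 - c1 / 2); split; [lra|].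
  intros u v Huv; set (L := v - u); assert (HL : 0 < L) by (unfold L; lra).
  destruct (covered_near_rational_line al be P1 P2 P3 u v) as (r1 & S1 & Hr1 & HS1); auto.
  destruct (covered_near_rational_line al be Q1 Q2 Q3 u v) as (r2 & S2 & Hr2 & HS2); auto.
  destruct (covered_near_rational_line al be T1 T2 T3 u v) as (r3 & S3 & Hr3 & HS3); auto.
  fold L in HS1, HS2, HS3.
  assert (HML : 0 < 6 * M / L) by (apply Rdiv_lt_0_compat; lra).
  set (bound := Rabs n0 + Rabs S1 + Rabs S2 + Rabs S3 + Rabs Q0 + 6 * M / L + 1).
  assert (p0 := Rabs_pos n0); assert (p1 := Rabs_pos S1); assert (p2 := Rabs_pos S2).
  assert (p3 := Rabs_pos S3); assert (p4 := Rabs_pos Q0).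
  assert (a0 := Rle_abs n0); assert (a1 := Rle_abs S1); assert (a2 := Rle_abs S2).
  assert (a3 := Rle_abs S3); assert (a4 := Rle_abs Q0).
  destruct (exists_nat_ceil bound) as (N & HN & _); [unfold bound; lra|].
  (* The sum of the three parameters yields one scale that suits all three families. *)
  destruct (exists_no_close_rational_line al be (r1 + r2 + r3) k N) as (n & Hn & Hno); [lra|auto|auto|].
  assert (HnN : INR N <= INR n) by (apply le_INR; exact Hn).
  specialize (Hwin n).
  assert (HSn : INR n <= INR (k * n)) by (apply le_INR; nia).
  set (S := INR (k * n)) in *.
  assert (HSb : bound < S) by lra; unfold bound in HSb, HN.
  assert (HS0 : 0 < S) by lra.
  set (B := fun x => near_rational_line al be P1 P2 P3 S x \/
    near_rational_line al be Q1 Q2 Q3 S x \/ near_rational_line al be T1 T2 T3 S x).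
  assert (HB : covered (fun x => B x /\ u <= x < v) (L / 6)).
  { assert (c1' := HS1 S ltac:(lra) (no_close_rational_line_mono al be (r1 + r2 + r3) r1 S HS0 ltac:(lra) Hno)).
    assert (c2' := HS2 S ltac:(lra) (no_close_rational_line_mono al be (r1 + r2 + r3) r2 S HS0 ltac:(lra) Hno)).
    assert (c3' := HS3 S ltac:(lra) (no_close_rational_line_mono al be (r1 + r2 + r3) r3 S HS0 ltac:(lra) Hno)).
    eapply covered_mono; [| |exact (covered_union _ _ _ _ c1' (covered_union _ _ _ _ c2' c3'))].
    - unfold B; tauto.
    (* Each family takes at most [128 / 10000 + / 24] of [L], and three times this is below
       [/ 6]. *)
    - apply (Rmult_le_compat_r L) in HP, HQ, HT; lra. }
  assert (HS3' : 1 < S ^ 3 /\ S <= S ^ 3).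
  { assert (1 < S) by lra; assert (1 < S * S) by nra; simpl; split; nra. }
  set (t := L * S ^ 3 / (6 * M)).
  assert (Ht : 1 < t).
  { apply (Rmult_lt_reg_r (6 * M / L)); [exact HML|].
    unfold t; replace (L * S ^ 3 / (6 * M) * (6 * M / L)) with (S ^ 3) by (field; lra); lra. }
  destruct (exists_nat_ceil (t - 1)) as (K & HK1 & HK2); [lra|].
  assert (HK0 : 1 <= INR K).
  { destruct K; [simpl in HK1; lra|]; rewrite S_INR; assert (h := pos_INR K); lra. }
  set (lam := L / INR K).
  assert (Hlam : INR K * lam = L) by (unfold lam; field; lra).
  assert (HtS : t * (6 * M) = L * S ^ 3) by (unfold t; field; lra).
  assert (Hlam0 : 0 < lam) by (apply Rdiv_lt_0_compat; lra).
  (* The window starts within [M / S ^ 3] of the middle third and has length at most [M / S ^ 3]; a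
     margin [lam / 3] of twice that size keeps it inside the cell. *)
  assert (Hlam1 : 6 * (M / S ^ 3) <= lam).
  { apply (Rmult_le_reg_r (INR K * S ^ 3)); [nra|].
    replace (6 * (M / S ^ 3) * (INR K * S ^ 3)) with (INR K * (6 * M)) by (field; lra).
    replace (lam * (INR K * S ^ 3)) with (L * S ^ 3) by (rewrite <- Hlam; ring).
    rewrite <- HtS; apply Rmult_le_compat_r; lra. }
  assert (Hlam2 : lam <= 12 * (M / S ^ 3)).
  { apply (Rmult_le_reg_r (INR K * S ^ 3)); [nra|].
    replace (12 * (M / S ^ 3) * (INR K * S ^ 3)) with (2 * INR K * (6 * M)) by (field; lra).
    replace (lam * (INR K * S ^ 3)) with (L * S ^ 3) by (rewrite <- Hlam; ring).
    rewrite <- HtS; apply Rmult_le_compat_r; lra. }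
  assert (HMS : c / S ^ 3 <= M / S ^ 3).
  { apply Rmult_le_compat_r; [left; apply Rinv_0_lt_compat|]; lra. }
  assert (HcS : 0 < c / S ^ 3) by (apply Rdiv_lt_0_compat; lra).
  assert (Hcl : c1 * lam <= c / S ^ 3).
  { apply Rle_trans with (c1 * (12 * (M / S ^ 3))); [apply Rmult_le_compat_l; lra|].
    right; unfold c1; field; lra. }
  assert (HKv : u + INR K * lam = v) by (rewrite Hlam; unfold L; ring).
  eapply covered_mono; [| |apply (covered_packing E B lam c1 K u (L / 6) Hlam0)].
  - rewrite HKv; tauto.
  - rewrite Hlam; lra.
  - lra.
  - intros i Hi; set (a := u + INR i * lam).
    destruct (classic (forall x, a + lam / 3 <= x < a + 2 * lam / 3 -> B x)) as [h|h]; [left; exact h|right].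
    apply not_all_ex_not in h as (x & h); apply imply_to_and in h as (Hx & HxB).
    assert (Hai : u + INR (Datatypes.S i) * lam = a + lam) by (unfold a; rewrite S_INR; ring).
    rewrite Hai.
    destruct (Hwin x) as (w & Hw & Hwx); [lra|unfold B in HxB; tauto|unfold B in HxB; tauto|
      unfold B in HxB; tauto|].
    assert (Hw' : - (M / S ^ 3) <= w - x <= M / S ^ 3).
    { revert Hw; unfold Rabs; destruct Rcase_abs; lra. }
    assert (H1 := covered_interval a w ltac:(lra)).
    assert (H2 := covered_interval (w + c / S ^ 3) (a + lam) ltac:(lra)).
    eapply covered_mono; [| |exact (covered_union _ _ _ _ H1 H2)].
    + intros y [Hy Hya].
      destruct (Rlt_le_dec y w) as [h1|h1]; [left; lra|].
      destruct (Rlt_le_dec y (w + c / S ^ 3)) as [h2|h2]; [exfalso|right; lra].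
      destruct (Hwx y) as (Q & HQS & HQn); [lra|].
      apply HQn, Hy; nra.
    + lra.
  - rewrite HKv; exact HB.
Qed.

Lemma improvable_mono (sg sg' Q : R) (v : R * R) :
  0 < Q -> sg <= sg' -> improvable sg Q v -> improvable sg' Q v.
Proof.
  intros HQ Hs (q & p1 & p2 & H1 & H2 & H3); exists q, p1, p2; split; [exact H1|].
  assert (0 < / sqrt Q) by (apply Rinv_0_lt_compat, sqrt_lt_R0; exact HQ).
  split; nra.
Qed.

(** In terms of the abscissa the line is [y = al * x + be], and it is not rational since it carries
    a badly approximable vector. A single [n] bounding [Q0], [|x|] and [/ (1 - sg)] makes the union
    countable. *)
Lemma null_DI_on_nonvertical_line (a b : R * R) :
  fst b <> 0 -> (exists t0, badly_approximable (line_pt a b t0)) ->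
  lebesgue_null (fun t => exists sg, 0 < sg < 1 /\ DI sg (line_pt a b t)).
Proof.
  intros Hb (t0 & Hbad).
  set (al := snd b / fst b); set (be := snd a - al * fst a).
  assert (Hpt : forall t, line_pt a b t = (fst a + t * fst b, al * (fst a + t * fst b) + be)).
  { intros t; unfold line_pt, be, al; f_equal; field; exact Hb. }
  assert (Hirr : ~ rational_line al be).
  { intros (A & B & C & HB & HA & HC); rewrite Hpt in Hbad; revert Hbad.
    set (x := fst a + t0 * fst b).
    destruct (Z.lt_total 0 B) as [h|[h|h]]; [|congruence|].
    - apply (badly_approximable_not_on_rational_line _ _ A B C h).
      replace (IZR A * x + IZR B * (al * x + be)) with ((IZR A + al * IZR B) * x + IZR B * be) by ring.
      rewrite HA; lra.
    - apply (badly_approximable_not_on_rational_line _ _ (- A) (- B) (- C)); [lia|].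
      rewrite !opp_IZR.
      replace (- IZR A * x + - IZR B * (al * x + be))
        with (- ((IZR A + al * IZR B) * x) - IZR B * be) by ring.
      rewrite HA; lra. }
  (* The values increase to 1; the shift by 2 makes them start at [/ 2], inside [(0, 1)]. *)
  set (sg := fun n : nat => 1 - / INR (n + 2)).
  assert (Hsg : forall n, 0 < sg n < 1).
  { intros n; unfold sg; rewrite plus_INR; simpl; assert (h := pos_INR n).
    assert (h1 : 0 < / (INR n + (1 + 1))) by (apply Rinv_0_lt_compat; lra).
    assert (h2 : / (INR n + (1 + 1)) <= / 2) by (apply Rinv_le_contravar; lra).
    lra. }
  set (E := fun (n : nat) x =>
    (forall Q, INR n <= Q -> 0 < Q -> improvable (sg n) Q (x, al * x + be)) /\
    - INR n <= x < INR n).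
  apply (lebesgue_null_increasing_union _ (fun n t => E n (fst a + t * fst b))).
  - intros t (s & Hs & Q0 & HQ0).
    set (x := fst a + t * fst b).
    assert (His : 0 < / (1 - s)) by (apply Rinv_0_lt_compat; lra).
    assert (px := Rabs_pos x); assert (pQ := Rabs_pos Q0); assert (aQ := Rle_abs Q0).
    destruct (exists_nat_ceil (Rabs x + Rabs Q0 + / (1 - s))) as (n & Hn & _); [lra|].
    exists n; split.
    + intros Q HnQ HQ; apply (improvable_mono s); [exact HQ| |].
      * unfold sg; assert (h : / INR (n + 2) <= 1 - s); [|lra].
        rewrite <- (Rinv_inv (1 - s)); apply Rinv_le_contravar; [exact His|].
        rewrite plus_INR; simpl; lra.
      * assert (Hp := Hpt t); fold x in Hp; fold x; rewrite <- Hp; apply HQ0; lra.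
    + fold x; revert Hn; unfold Rabs; destruct (Rcase_abs x); destruct (Rcase_abs Q0); lra.
  - intros n eps Heps.
    destruct (improvable_set_contraction al be (sg n) (INR n) (Hsg n) Hirr) as (c & Hc & Hcov).
    assert (Hb' : 0 < Rabs (fst b)) by (apply Rabs_pos_lt; exact Hb).
    eapply covered_mono; [| |apply (covered_affine_preimage (E n) (fst a) (fst b)
      (eps * Rabs (fst b) / 2) Hb)]; [tauto| |].
    + right; field; lra.
    + apply (covered_arbitrarily_small _ c Hc Hcov); nra.
Qed.

(** * Exchange of coordinates and the vertical case *)

Definition swap (v : R * R) : R * R := (snd v, fst v).

Lemma supnorm2_approx_err_swap (v : R * R) q p1 p2 :
  supnorm2 (approx_err (swap v) q p1 p2) = supnorm2 (approx_err v q p2 p1).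
Proof.
  unfold supnorm2, approx_err, swap; simpl; apply Rmax_comm.
Qed.

Lemma DI_swap sg v : DI sg v -> DI sg (swap v).
Proof.
  intros (Q0 & H); exists Q0; intros Q h1 h2.
  destruct (H Q h1 h2) as (q & p1 & p2 & H'); exists q, p2, p1.
  rewrite supnorm2_approx_err_swap; exact H'.
Qed.

Lemma badly_approximable_swap v : badly_approximable v -> badly_approximable (swap v).
Proof.
  intros (c & Hc & H); exists c; split; [exact Hc|]; intros q p1 p2 Hq.
  rewrite supnorm2_approx_err_swap; apply H; exact Hq.
Qed.

Lemma lebesgue_null_mono (S T : R -> Prop) :
  (forall x, S x -> T x) -> lebesgue_null T -> lebesgue_null S.
Proof.
  intros HST HT eps Heps; destruct (HT eps Heps) as (l & r & H1 & H2 & H3).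
  exists l, r; auto.
Qed.

Theorem theorem1p1 (a b : R * R) :
  b <> (0, 0) ->
  (exists t0 : R, badly_approximable (line_pt a b t0)) ->
  lebesgue_null (fun t : R => ~ no_improvement_Dirichlet (line_pt a b t)).
Proof.
  intros Hb (t0 & Hbad).
  (* A vertical line becomes horizontal when the coordinates are exchanged, which preserves both
     [DI] and bad approximability. *)
  destruct (Req_dec (fst b) 0) as [E|E].
  - assert (E' : fst (swap b) <> 0).
    { simpl; intros E'; apply Hb; destruct b; simpl in *; congruence. }
    assert (Hnull := null_DI_on_nonvertical_line (swap a) (swap b) E'
      (ex_intro _ t0 (badly_approximable_swap _ Hbad))).
    refine (lebesgue_null_mono _ _ _ Hnull); intros t Ht.
    apply NNPP in Ht as (sg & Hsg & HDI); exists sg; split; [exact Hsg | exact (DI_swap _ _ HDI)].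
  - assert (Hnull := null_DI_on_nonvertical_line a b E (ex_intro _ t0 Hbad)).
    refine (lebesgue_null_mono _ _ _ Hnull); intros t Ht; exact (NNPP _ Ht).
Qed.
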